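(* Let $\alpha$ be a real quadratic irrationality (i.e., a real number with $[\mathbf{Q}(\alpha):\mathbf{Q}]=2$) and let $k$ be a positive integer. Then \[ \frac{\psi(\alpha,2k)}{\pi^{2k}}\in\mathbf{Q}(\alpha). \] Moreover, if $x\mapsto x'$ denotes the nontrivial automorphism of $\mathbf{Q}(\alpha)$, then \[ \left(\frac{\psi(\alpha,2k)}{\pi^{2k}}\right)'=\frac{\psi(\alpha',2k)}{\pi^{2k}}. \]
   Context: For an algebraic irrational real number $\alpha$, the secant zeta function is defined (for $\mathrm{Re}(s)$ large enough, where the series converges absolutely) by the Dirichlet series $\psi(\alpha,s)=\sum_{n=1}^\infty \frac{\sec(\pi n\alpha)}{n^s}$. For a real quadratic irrationality $\alpha$ and a positive integer $k$, the series converges absolutely at $s=2k$, and $\psi(\alpha,2k)$ denotes its sum. *)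

(* Defs.v *)
From HB Require Import structures.
From mathcomp Require Import all_boot all_order all_algebra.
From mathcomp Require Import all_classical all_reals all_analysis.
Import numFieldNormedType.Exports.

Set Implicit Arguments.
Unset Strict Implicit.
Unset Printing Implicit Defensive.

Import Order.TTheory GRing.Theory Num.Theory.

Local Open Scope classical_set_scope.
Local Open Scope ring_scope.

(* A subfield of R always contains the prime field, so the smallest subfield
   containing a is Q(a). Since 0^-1 = 0, divring_closed A says exactly that A is
   a subfield. *)
Definition Qadjoin (R : realType) (a : R) : {pred R} :=
  fun x => x \in smallest (fun A : set R => divring_closed (mem A)) [set a].

Lemma Qadjoin_divring (R : realType) (a : R) : divring_closed (Qadjoin a).
Proof.
have inP x : reflect (forall A : set R, divring_closed (mem A) -> a \in A -> x \in A)
    (x \in Qadjoin a).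
  apply: (iffP idP) => [|H].
    by rewrite /Qadjoin unfold_in /= in_setE => H A cA Aa; rewrite in_setE;
      apply: H; split=> // _ ->; rewrite -in_setE.
  rewrite /Qadjoin unfold_in /= in_setE => A [cA Aa].
  by rewrite -in_setE; apply: H => //; rewrite in_setE; apply: Aa.
split=> [|x y /inP Sx /inP Sy|x y /inP Sx /inP Sy]; apply/inP => A cA Aa.
- by case: cA.
- by case: (cA) => _ + _; apply; [apply: Sx|apply: Sy].
- by case: (cA) => _ _; apply; [apply: Sx|apply: Sy].
Qed.

Lemma Qadjoin_id (R : realType) (a : R) : a \in Qadjoin a.
Proof. by rewrite /Qadjoin unfold_in /= in_setE => A [_]; apply. Qed.

HB.instance Definition _ (R : realType) (a : R) :=
  GRing.isDivringClosed.Build R (Qadjoin a) (Qadjoin_divring a).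

Record Qfield (R : realType) (a : R) :=
  InQfield { Qval : R; QvalP : Qval \in Qadjoin a }.

HB.instance Definition _ (R : realType) (a : R) := [isSub for @Qval R a].
HB.instance Definition _ (R : realType) (a : R) := [Choice of Qfield a by <:].
HB.instance Definition _ (R : realType) (a : R) :=
  [SubChoice_isSubIntegralDomain of Qfield a by <:].
HB.instance Definition _ (R : realType) (a : R) :=
  [SubIntegralDomain_isSubField of Qfield a by <:].

Definition Qgen (R : realType) (a : R) : Qfield a := InQfield (Qadjoin_id a).

(* [K : Q] = n, for K of characteristic 0 (where ratr is the embedding of Q):
   some n-tuple is a basis of K over Q. *)
Definition degree_over_rat (K : fieldType) (n : nat) : Prop :=
  exists e : 'I_n -> K,
    forall x : K, exists! c : {ffun 'I_n -> rat}, x = \sum_(i < n) ratr (c i) * e i.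

Definition quadratic_irrationality (R : realType) (a : R) : Prop :=
  degree_over_rat (Qfield a) 2.

Definition sec (R : realType) (x : R) : R := (cos x)^-1.

(* psi(a, s), for s a natural number; the big operator over (1 <= n <oo) is the
   limit of the partial sums. *)
Definition secant_zeta (R : realType) (a : R) (s : nat) : R :=
  \big[+%R/0]_(1 <= n <oo) (sec (pi * n%:R * a) / n%:R ^+ s).

(* Main.v *)
(** Write [a = 2 alpha], [chi] for the sign [(-1)^l] attached to the odd integer [mu = 2 l + 1],
    and expand [sec (pi n alpha) = 1 + (4 / pi) sum_mu chi (a n)^2 / (mu (mu^2 - (a n)^2))].  Since
    [a] is badly approximable, dividing by [n^(2k)] and summing over [n] gives a double series that
    can be summed over [n] first; splitting [1 / (n^(2k-2) (mu^2 - a^2 n^2))] into partial fractions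
    turns it into [psi(alpha, 2k) = E(a) + (2 / pi) a^(2k-1) Phi(1 / a)], where [E] is [pi^(2k)]
    times a rational polynomial and [Phi(x) = sum_mu chi pi cot(pi mu x) / mu^(2k)] has period 1.
    With [psi(alpha + 2, 2k) = psi(alpha, 2k)] this yields, for every [M = (a b; c d)] in the
    principal congruence subgroup of level 2, a relation
    [psi(x) - eps (c x + d)^(2k-1) psi(M x) = pi^(2k) F(x)] with [eps = 1] or [-1] and [F] a rational
    function over Q which does not depend on [x].  If [A x^2 + B x + C = 0], a solution of Pell's
    equation for [B^2 - 4 A C] provides such an [M] fixing both roots, with [c x + d] different from
    [1] and [-1]; solving for [psi(x)] gives the same rational expression at [alpha] and [alpha']. *)

From HB Require Import structures.
Require Import Defs.
From mathcomp Require Import all_boot all_order all_algebra.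
From mathcomp Require Import all_classical all_reals all_analysis.
From mathcomp Require Import ring lra zify.
Import Order.TTheory GRing.Theory Num.Theory.
Import numFieldNormedType.Exports.

Set Implicit Arguments.
Unset Strict Implicit.
Unset Printing Implicit Defensive.

Local Open Scope classical_set_scope.
Local Open Scope ring_scope.

(** * Series *)

(** The exchange of summations is the obstacle: [mu^2 - (a n)^2] can come close to [0], and the
    double series is dominated only because such near misses are sparse, which is what bad
    approximability gives. Separating off the value [1] of the secant replaces terms of size
    [1 / mu] by terms of size [1 / mu^3]; otherwise there would be no absolute convergence in [mu].
    The convergence of [Phi], whose cotangents can be large, is not shown directly but falls out of
    the dominated exchange. Level 2 comes from the doubling [a = 2 alpha]: shifting [1 / a] by an
    integer is the map [x -> x / (1 - 2 z x)], the other symmetry is [x -> x + 2], and [eps]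
    accounts for the matrix [-1], which these two do not produce. Conjugation cannot be carried
    through a limit, so each relation is kept as an expression that makes sense in every field. The
    rationality of [E] comes from comparing coefficients at [0] in [cot * sin = cos] and
    [sec * cos = 1], for which asymptotic expansions suffice. *)

Section Series.
Variable R : realType.
Implicit Types (u A : nat -> R) (B e : R).

Lemma cvg_abs_sum u B : (forall N, \sum_(i < N) `|u i| <= B) ->
  cvgn (fun N => \sum_(i < N) u i).
Proof.
move=> ub; have -> : (fun N => \sum_(i < N) u i) = series u.
  by rewrite seriesEord.
apply: normed_cvg; apply: nondecreasing_is_cvgn.
  by apply: nondecreasing_series => n _ _; exact: normr_ge0.
exists B => _ [n _ <-]; rewrite /= /series /= big_mkord; exact: ub.
Qed.

Lemma cvg_sum (I : Type) (r : seq I) (f : I -> nat -> R) (l : I -> R) :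
  (forall i, f i @ \oo --> l i) ->
  (fun n => \sum_(i <- r) f i n) @ \oo --> \sum_(i <- r) l i.
Proof.
move=> fl; apply: cvg_big => //; exact: add_continuous.
Qed.

Lemma sum_ord_diff u M0 M : (M0 <= M)%N ->
  \sum_(m < M) u m - \sum_(m < M0) u m = \sum_(M0 <= m < M) u m.
Proof.
move=> leM; rewrite -!(big_mkord xpredT u) (@big_cat_nat _ _ _ M0) //=.
by rewrite addrAC subrr add0r.
Qed.

Lemma sum_tail_le u A l e M0 :
  (forall m, `|u m| <= A m) -> (fun M => \sum_(m < M) u m) @ \oo --> l ->
  (forall M, (M0 <= M)%N -> \sum_(m < M) A m - \sum_(m < M0) A m <= e) ->
  `|l - \sum_(m < M0) u m| <= e.
Proof.
move=> uA ul tA; apply: (@cvgr_to_le _ (nbhs \oo) _ _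
   (fun M => `|\sum_(m < M) u m - \sum_(m < M0) u m|)).
  by apply: cvg_norm; apply: cvgB => //; exact: cvg_cst.
exists M0 => // M /= leM; apply: le_trans (tA _ leM).
rewrite !sum_ord_diff//.
exact: le_trans (ler_norm_sum _ _ _) (ler_sum _ _).
Qed.

Lemma sum_cauchy A B e : (forall m, 0 <= A m) -> (forall M, \sum_(m < M) A m <= B) ->
  0 < e -> exists M0, forall M, (M0 <= M)%N -> \sum_(m < M) A m - \sum_(m < M0) A m <= e.
Proof.
move=> A0 AB e0; have cA : cvgn (fun N => \sum_(i < N) A i).
  apply: (@cvg_abs_sum _ B) => N.
  by rewrite (eq_bigr (fun i : 'I_N => A i)) ?AB // => i _; rewrite ger0_norm.
have ndA : {homo (fun N => \sum_(i < N) A i) : n m / (n <= m)%N >-> n <= m}.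
  move=> n m nm; rewrite -subr_ge0 sum_ord_diff//.
  exact: sumr_ge0.
have /cvgrPdist_le/(_ e e0)[M0 _ HM0] := cA.
exists M0 => M leM; have := HM0 M0 (leqnn M0) => /=.
have := nondecreasing_cvgn_le ndA cA M; have := nondecreasing_cvgn_le ndA cA M0.
move=> /= h1 h2; rewrite ger0_norm ?subr_ge0// => h3; lra.
Qed.

(** Interchanges two summations: [s N m] is meant to be the sum of the first [N] entries of column
    [m], and [g N] the sum of the first [N] rows. As [A] does not depend on [N], one cut-off [M0]
    serves all [N]; the error splits into a tail of [h], a finite sum and a tail of [s N]. *)
Lemma tannery (s : nat -> nat -> R) (h g : nat -> R) A (B : R) :
  (forall N m, `|s N m| <= A m) -> (forall M, \sum_(m < M) A m <= B) ->
  (forall m, (fun N => s N m) @ \oo --> h m) ->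
  (forall N, (fun M => \sum_(m < M) s N m) @ \oo --> g N) ->
  exists2 l : R, (fun M => \sum_(m < M) h m) @ \oo --> l & g @ \oo --> l.
Proof.
move=> sA AB sh sg.
have A0 m : 0 <= A m by apply: le_trans (normr_ge0 _) (sA 0%N m).
have hA m : `|h m| <= A m.
  apply: (@cvgr_to_le _ (nbhs \oo) _ _ (fun N => `|s N m|)).
    exact: cvg_norm.
  by near=> N; exact: sA.
have ch : cvgn (fun M => \sum_(m < M) h m).
  apply: (@cvg_abs_sum _ B) => N; apply: le_trans (AB N).
  by apply: ler_sum => i _; exact: hA.
exists (limn (fun M => \sum_(m < M) h m)); first exact: ch.
apply/cvgrPdist_le => e e0; have e3 : 0 < e / 3 by lra.
have [M0 HM0] := sum_cauchy A0 AB e3.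
have t1 := sum_tail_le hA ch HM0.
have /cvgrPdist_le/(_ _ e3) := @cvg_sum _ (index_enum 'I_M0) _ _ (fun m : 'I_M0 => sh m).
apply: filterS => N /= t2; have t3 := sum_tail_le (sA N) (sg N) HM0.
move: t1 t2 t3; set l := limn _; set H := \sum_(i < _) h _; set S := \sum_(i < _) s _ _.
rewrite !ler_norml => /andP[? ?] /andP[? ?] /andP[? ?]; apply/andP; split; lra.
Unshelve. all: by end_near. Qed.

Lemma sum_inv_sq_le N : \sum_(i < N) (i.+1%:R ^+ 2)^-1 <= 2 :> R.
Proof.
(* [1 / n - 1 / (n + 1)] dominates [1 / (n + 1)^2], so the subtracted term makes the induction
   close. *)
suff H : forall n, \sum_(i < n.+1) (i.+1%:R ^+ 2)^-1 <= 2 - n.+1%:R^-1 :> R.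
  case: N => [|N]; first by rewrite big_ord0.
  by apply: le_trans (H N) _; rewrite gerBl.
elim=> [|n IH]; first by rewrite big_ord_recr big_ord0 /=; lra.
rewrite big_ord_recr /=; apply: le_trans (lerD IH (lexx _)) _.
have n0 : 0 < n.+1%:R :> R by [].
have -> : n.+2%:R = n.+1%:R + 1 :> R by rewrite -natr1.
move: n0; move: (n.+1%:R : R) => x x0.
rewrite -subr_ge0.
have -> : 2 - (x + 1)^-1 - (2 - x^-1 + (x + 1) ^- 2) = (x * (x + 1) ^+ 2)^-1.
  by field; apply/andP; split; lra.
by rewrite invr_ge0 mulr_ge0 ?exprn_ge0//; lra.
Qed.

Lemma sum_inv_sqrt_le N :
  \sum_(i < N) (i.+1%:R * Num.sqrt i.+1%:R)^-1 <= 3 :> R.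
Proof.
(* The same telescoping with [2 / sqrt n]: for consecutive square roots [x <= y], [y^2 - x^2 = 1]
   gives [1 / x - 1 / y = 1 / ((y + x) x y) >= 1 / (2 y^3)]. *)
suff H : forall n, \sum_(i < n.+1) (i.+1%:R * Num.sqrt i.+1%:R)^-1
    <= 3 - 2 * (Num.sqrt n.+1%:R)^-1 :> R.
  case: N => [|N]; first by rewrite big_ord0.
  by apply: le_trans (H N) _; rewrite gerBl mulr_ge0.
elim=> [|n IH]; first by rewrite big_ord_recr big_ord0 /= sqrtr1; lra.
rewrite big_ord_recr /=; apply: le_trans (lerD IH (lexx _)) _.
have x0 : 0 < Num.sqrt n.+1%:R :> R by rewrite sqrtr_gt0.
have y0 : 0 < Num.sqrt n.+2%:R :> R by rewrite sqrtr_gt0.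
have xy : Num.sqrt n.+1%:R <= Num.sqrt n.+2%:R :> R by rewrite ler_sqrt// ler_nat.
have xE := sqr_sqrtr (ler0n R n.+1); have yE := sqr_sqrtr (ler0n R n.+2).
have yx : Num.sqrt n.+2%:R ^+ 2 = Num.sqrt n.+1%:R ^+ 2 + 1 :> R.
  by rewrite yE xE -natr1.
rewrite -[X in (X * Num.sqrt n.+2%:R)]yE.
move: x0 y0 xy yx; move: (Num.sqrt n.+1%:R : R) (Num.sqrt n.+2%:R : R) => x y x0 y0 xy yx.
have h : y ^- 3 <= 2 * (x^-1 - y^-1).
  have -> : x^-1 - y^-1 = ((y + x) * x * y)^-1.
    have := subr_sqr y x; rewrite yx addrAC subrr add0r => E.
    have E' : (y - x) = (y + x)^-1.
      by apply: (mulIf (x := y + x)); [lra | rewrite -E mulVf//; lra].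
    rewrite !invfM -E'; field; lra.
  rewrite -ler_pdivrMl ?ltr0n// -invfM lef_pV2 ?posrE ?mulr_gt0 ?exprn_gt0//; last lra.
  by nra.
have -> : y ^+ 2 * y = y ^+ 3 by ring.
lra.
Qed.

End Series.

(** * Lattice sums for badly approximable numbers *)

Section LatticeSum.
Variable R : realType.

(** With the weight [|p| + |q|] the bound also makes sense for [q = 0], a case that arises when two
    lattice points are subtracted. *)
Definition badly_approximable (a : R) :=
  exists2 c : R, 0 < c & forall p q : int, (p != 0) || (q != 0) ->
    c <= `|p%:~R - a * q%:~R| * (`|p%:~R| + `|q%:~R|).

(** The elements of [E] are at least [g, 2 g, 3 g, ...], so the sum is comparable to [1 / g^2] times
    the sum of [1 / j^2]. *)
Lemma separated_sum_le (E : pred nat) (g : R) : 0 < g ->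
  (forall m, E m -> g <= m%:R) ->
  (forall m n, E m -> E n -> (m < n)%N -> m%:R + g <= n%:R) ->
  forall M, \sum_(m < M | E m) (m%:R ^+ 2)^-1 <= 3 / g ^+ 2 :> R.
Proof.
move=> g0 gE sE M.
(* [y] bounds the next element of [E] from below; a new term [1 / x^2] is paid by
   [2 / (g x) - 2 / (g y)], since [x >= g] and [y >= x + g]. *)
suff H : forall y : R, g <= y -> (forall m, (m < M)%N -> E m -> m%:R + g <= y) ->
    \sum_(m < M | E m) (m%:R ^+ 2)^-1 <= 3 / g ^+ 2 - 2 / (g * y).
  apply: le_trans (H (M%:R + g) _ _) _.
  - by rewrite lerDr.
  - by move=> m mM _; rewrite lerD2r ler_nat ltnW.
  - by rewrite gerBl divr_ge0// mulr_ge0 ?addr_ge0// ltW.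
elim: M => [|M IH] y gy Ey.
  rewrite big_ord0; have y0 : 0 < y by lra.
  have -> : 3 / g ^+ 2 - 2 / (g * y) = (3 * y - 2 * g) / (g ^+ 2 * y).
    by field; apply/andP; split; lra.
  by rewrite divr_ge0 ?mulr_ge0 ?exprn_ge0//; lra.
rewrite big_mkcond big_ord_recr /= -big_mkcond /=; case: ifPn => [EM|_]; last first.
  by rewrite addr0; apply: IH => // m mM; apply: Ey; rewrite ltnS ltnW.
have gM := gE _ EM; have My := Ey M (ltnSn M) EM.
have : \sum_(m < M | E m) (m%:R ^+ 2)^-1 <= 3 / g ^+ 2 - 2 / (g * M%:R).
  by apply: IH => // m mM Em; apply: sE.
move=> /(fun h => lerD h (lexx (M%:R ^- 2))) /le_trans; apply.
move: gM My; move: (M%:R : R) => x gx xy; have x0 : 0 < x by lra.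
have y0 : 0 < y by lra.
rewrite -subr_ge0.
have -> : 3 / g ^+ 2 - 2 / (g * y) - (3 / g ^+ 2 - 2 / (g * x) + x ^- 2) =
    (2 * x * (y - x) - g * y) / (g * x ^+ 2 * y).
  by field; rewrite !gt_eqF.
by rewrite divr_ge0 ?mulr_ge0 ?exprn_ge0//; [nra | lra..].
Qed.

(** When [a q] is near [p], [|q|] is at most about [|p| / a], so the Diophantine bound becomes a
    lower bound for [|p|]. The numerator [2] leaves room for the difference of two points, each
    within [1 / T]. *)
Lemma badly_approximable_sep (a : R) : 0 < a -> badly_approximable a ->
  exists k t0 : R, [/\ 0 < k, 0 < t0 & forall (T : R) (p q : int), t0 <= T ->
    p != 0 -> `|p%:~R - a * q%:~R| <= 2 / T -> k * T <= `|p%:~R|].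
Proof.
move=> a0 [c c0 Hc].
(* For [T >= t0] the error contribution [4 / (a T^2)] is at most [c / 2]; the other half of [c]
   gives the constant [k]. *)
exists (c / 4 / (1 + a^-1)), (1 + 8 / (a * c)).
have ai : 0 < a^-1 by rewrite invr_gt0.
have ac : 0 < 8 / (a * c) by rewrite divr_gt0// mulr_gt0.
split; [by rewrite !divr_gt0//; lra | lra | move=> T p q tT p0].
have T0 : 0 < T by lra.
have := Hc p q; rewrite p0 => /(_ isT).
move: (ler_normD (a * q%:~R - p%:~R) p%:~R); rewrite subrK normrM (gtr0_norm a0) distrC.
set x := `|p%:~R|; set y := `|q%:~R|; set e := `|_ - _| => hq hc he.
have x0 : 0 <= x by exact: normr_ge0.
have e0 : 0 <= e by exact: normr_ge0.
have hy : y <= (2 / T + x) * a^-1 by rewrite ler_pdivlMr// mulrC; lra.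
have hT : 0 < 2 / T by rewrite divr_gt0.
have h1 : c <= 2 / T * (x + (2 / T + x) * a^-1).
  by apply: le_trans hc _; apply: ler_pM => //; [rewrite addr_ge0 ?normr_ge0 | lra].
have h2 : 4 / T ^+ 2 * a^-1 <= c / 2.
  rewrite ler_pdivrMr// ler_pdivrMr ?exprn_gt0//.
  have : 8 / (a * c) <= T ^+ 2 by nra.
  rewrite ler_pdivrMr ?mulr_gt0//; nra.
have h3 : c / 2 <= 2 / T * x * (1 + a^-1).
  rewrite (_ : 4 / T ^+ 2 / a = 2 / T * (2 / T) / a) in h2; last by field; rewrite !gt_eqF.
  nra.
rewrite mulrAC ler_pdivrMr; last lra.
have : c / 2 * T <= 2 * (x * (1 + a^-1)).
  rewrite -ler_pdivlMr//; move: h3; rewrite (_ : 2 / T * x * (1 + a^-1) = 2 * (x * (1 + a^-1)) / T) //.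
  by ring.
lra.
Qed.

Lemma sum_inv_sq0_le N : \sum_(i < N) (i%:R ^+ 2)^-1 <= 2 :> R.
Proof.
case: N => [|N]; first by rewrite big_ord0.
by rewrite big_ord_recl expr0n invr0 add0r; exact: sum_inv_sq_le.
Qed.

(* Dyadic decomposition: if [T <= t m] then [m] is at least of order [T], and two such [m] differ
   by at least that much, so the [m] with [T <= t m < 2 T] contribute [O(1 / T)]. *)
Lemma near_sum_le (a : R) (v : nat -> nat) : 0 < a -> badly_approximable a ->
  exists B : R, forall M, \sum_(m < M) (m%:R ^+ 2 * `|m%:R - a * (v m)%:R|)^-1 <= B.
Proof.
move=> a0 ba; have [k [t0 [k0 t00 Hk]]] := badly_approximable_sep a0 ba.
exists (2 * t0 + 12 / (t0 * k ^+ 2)) => M.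
pose t m := `|m%:R - a * (v m)%:R|^-1.
have tge0 m : 0 <= t m by rewrite invr_ge0.
have k2 : 0 < k ^+ 2 by rewrite exprn_gt0.
(* The block [T <= t m < 2 T] with [T = t0 2^L] costs [2 T * 3 / (k T)^2], and these costs form a
   geometric series; the [m] with [t m < t0] account for [2 t0]. *)
have H : forall L, \sum_(m < M | t m < t0 * 2 ^+ L) t m / m%:R ^+ 2
    <= 2 * t0 + 12 / (t0 * k ^+ 2) * (1 - 2 ^- L).
  elim=> [|L IH].
    rewrite invr1 subrr mulr0 addr0 mulr1.
    apply: (@le_trans _ _ (t0 * \sum_(m < M) (m%:R ^+ 2)^-1)); last first.
      by rewrite mulrC ler_pM2r// sum_inv_sq0_le.
    rewrite mulr_sumr [leLHS]big_mkcond /=; apply: ler_sum => m _.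
    case: ifPn => h; last by rewrite mulr_ge0 ?invr_ge0 ?exprn_ge0// ltW.
    by rewrite ler_wpM2r ?invr_ge0 ?exprn_ge0// ltW.
  have p2 : 0 < 2 ^+ L :> R by rewrite exprn_gt0.
  set T := t0 * 2 ^+ L.
  have T0 : 0 < T by rewrite mulr_gt0.
  have tT : t0 <= T by rewrite ler_pMr// exprn_ege1// ler1n.
  (* [m = 0] is left out because the separation needs a nonzero first coordinate; its term vanishes
     since [0^-1 = 0]. *)
  pose E := [pred m : nat | (T <= t m) && (0 < m)%N].
  have near m : E m -> `|m%:R - a * (v m)%:R| <= T^-1.
    move=> /andP[Tt m0]; rewrite -[leLHS]invrK lef_pV2 ?posrE// (lt_le_trans T0)//.
  have S : \sum_(m < M | E m) (m%:R ^+ 2)^-1 <= 3 / (k * T) ^+ 2 :> R.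
    apply: separated_sum_le; first by rewrite mulr_gt0.
    - move=> m Em; have /andP[_ m0] := Em.
      have := Hk T m%:Z (v m)%:Z tT; rewrite -!pmulrn => /(_ _ _)/le_trans-> //.
      + by rewrite eqz_nat -lt0n.
      + by apply: le_trans (near _ Em) _; rewrite ler_peMl ?ler1n// invr_ge0 ltW.
      + by rewrite ger0_norm.
    - move=> m n Em En mn; rewrite addrC -lerBrDr.
      have := Hk T (n%:Z - m%:Z) ((v n)%:Z - (v m)%:Z) tT.
      rewrite !rmorphB /= -!pmulrn => /(_ _ _)/le_trans-> //.
      + by rewrite subr_eq0 eqz_nat gtn_eqF.
      + rewrite (_ : _ - _ = (n%:R - a * (v n)%:R) - (m%:R - a * (v m)%:R)); last by ring.
        apply: le_trans (ler_normB _ _) _.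
        have := near _ Em; have := near _ En; lra.
      + by rewrite ger0_norm// subr_ge0 ler_nat ltnW.
  have -> : \sum_(m < M | t m < t0 * 2 ^+ L.+1) t m / m%:R ^+ 2 =
     \sum_(m < M | t m < T) t m / m%:R ^+ 2 +
     \sum_(m < M | (t m < t0 * 2 ^+ L.+1) && (T <= t m)) t m / m%:R ^+ 2.
    rewrite (bigID (fun m : 'I_M => t m < T)) /=; congr (_ + _); apply: eq_bigl => m.
      rewrite andb_idl// => /lt_le_trans; apply; rewrite exprS mulrCA -/T; lra.
    by rewrite -leNgt.
  have h2 : \sum_(m < M | (t m < t0 * 2 ^+ L.+1) && (T <= t m)) t m / m%:R ^+ 2
      <= (2 * T) * (3 / (k * T) ^+ 2).
    apply: le_trans (ler_wpM2l _ S); last by rewrite mulr_ge0// ltW.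
    rewrite mulr_sumr [leLHS]big_mkcond [leRHS]big_mkcond /=; apply: ler_sum => m _.
    have [m0|] := posnP m.
      by rewrite m0 expr0n /= invr0 !mulr0 !if_same.
    move=> m0; rewrite andbT; case: (leP T (t m)) => /= h; last by rewrite andbF.
    rewrite andbT; case: ifP => h'.
      rewrite ler_wpM2r ?invr_ge0 ?exprn_ge0// ltW// (lt_le_trans h')//.
      by rewrite exprS /T; lra.
    by rewrite mulr_ge0 ?invr_ge0 ?exprn_ge0// mulr_ge0// ltW.
  apply: le_trans (lerD IH h2) _; rewrite -subr_ge0.
  have -> : 2 * T * (3 / (k * T) ^+ 2) = 12 / (t0 * k ^+ 2) * (2 ^- L - 2 ^- L.+1).
    rewrite [2 ^+ L.+1]exprS /T; move: (2 ^+ L) p2 => P P0; field.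
    by rewrite !gt_eqF.
  by rewrite le_eqVlt; apply/orP; left; apply/eqP; ring.
(* Gives a crude dyadic level above the finitely many [t m]; the bound in [H] stays below a constant
   independent of the level. *)
pose x := (\sum_(m < M) t m) / t0.
have x0 : 0 <= x by rewrite divr_ge0 ?sumr_ge0// ltW.
have tx m : (m < M)%N -> t m < t0 * 2 ^+ (Num.truncn x).+1.
  move=> mM; apply: (@le_lt_trans _ _ (t0 * x)).
    rewrite mulrCA divff ?gt_eqF// mulr1 (bigD1 (Ordinal mM))//= lerDl.
    by apply: sumr_ge0.
  rewrite ltr_pM2l//; have /andP[_ /lt_trans] := truncn_itv x0; apply.
  by rewrite -natrX ltr_nat ltn_expl.
have := H (Num.truncn x).+1.
rewrite (eq_bigl xpredT) => [h|m]; last by rewrite tx.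
have -> : \sum_(m < M) (m%:R ^+ 2 * `|m%:R - a * (v m)%:R|)^-1 =
    \sum_(m < M) t m / m%:R ^+ 2.
  by apply: eq_bigr => m _; rewrite invfM mulrC.
apply: le_trans h _; rewrite lerD2l -[leRHS]mulr1 ler_wpM2l//.
by rewrite divr_ge0// mulr_ge0// ltW.
Qed.

Lemma badly_approximable_neq (a : R) (m n : nat) :
  badly_approximable a -> (0 < m)%N -> m%:R - a * n%:R != 0.
Proof.
move=> [c c0 H] m0; apply/eqP => h.
have := H m%:Z n%:Z; rewrite -!pmulrn h normr0 mul0r eqz_nat -lt0n m0 => /(_ isT).
by move/(lt_le_trans c0); rewrite ltxx.
Qed.

(** [m + a n] is at least [m] and at least [r], hence at least the geometric mean of [m] and
    [a (i + 1)]. The resulting exponents [3 / 2] are summable both in [m] and in [i]. *)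
Lemma lattice_term_le (a r m : R) (n i : nat) : 0 < a -> 0 < m -> r = `|m - a * n%:R| ->
  0 < r -> a * i.+1%:R <= r ->
  (m * `|m ^+ 2 - a ^+ 2 * n%:R ^+ 2|)^-1 <=
  (m * Num.sqrt m)^-1 * (a * Num.sqrt a)^-1 * (i.+1%:R * Num.sqrt i.+1%:R)^-1.
Proof.
move=> a0 m0 rE r0 ir; have n0 : 0 <= n%:R :> R by [].
have -> : `|m ^+ 2 - a ^+ 2 * n%:R ^+ 2| = r * (m + a * n%:R).
  rewrite rE -exprMn subr_sqr normrM; congr (_ * _); rewrite ger0_norm//; nra.
have rm : r <= m + a * n%:R by rewrite rE ler_norml; apply/andP; split; nra.
rewrite -!invfM lef_pV2 ?posrE ?mulr_gt0 ?sqrtr_gt0//; last by nra.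
have -> : m * Num.sqrt m * (a * Num.sqrt a) * (i.+1%:R * Num.sqrt i.+1%:R) =
    m * (a * i.+1%:R * (Num.sqrt m * Num.sqrt (a * i.+1%:R))).
  rewrite sqrtrM 1?ltW//; ring.
have i0 : 0 < i.+1%:R :> R by [].
rewrite ler_pM2l//; apply: ler_pM;
  [by rewrite mulr_ge0// ltW | by rewrite mulr_ge0 ?sqrtr_ge0 | exact: ir |].
have h1 : Num.sqrt m <= Num.sqrt (m + a * n%:R) by rewrite ler_sqrt; nra.
have h2 : Num.sqrt (a * i.+1%:R) <= Num.sqrt (m + a * n%:R) by rewrite ler_sqrt; nra.
apply: le_trans (ler_pM (sqrtr_ge0 _) (sqrtr_ge0 _) h1 h2) _.
by rewrite -expr2 sqr_sqrtr//; nra.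
Qed.

Lemma lattice_term_near_le (a m : R) (n : nat) : 0 < a -> 0 < m -> m - a * n%:R != 0 ->
  (m * `|m ^+ 2 - a ^+ 2 * n%:R ^+ 2|)^-1 <= (m ^+ 2 * `|m - a * n%:R|)^-1.
Proof.
move=> a0 m0 r0; have n0 : 0 <= n%:R :> R by [].
have r1 : 0 < `|m - a * n%:R| by rewrite normr_gt0.
have -> : `|m ^+ 2 - a ^+ 2 * n%:R ^+ 2| = `|m - a * n%:R| * (m + a * n%:R).
  rewrite -exprMn subr_sqr normrM; congr (_ * _); rewrite ger0_norm//; nra.
have an : 0 <= a * n%:R by rewrite mulr_ge0// ltW.
rewrite lef_pV2 ?posrE ?mulr_gt0//; last lra.
rewrite expr2 -mulrA ler_pM2l// mulrC ler_pM2l//; lra.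
Qed.

(** For each [m] the two integers [n0 m] and [n0 m + 1] around [m / a] are left to the dyadic
    estimate; any [n] lying [i + 1] steps outside them has [|m - a n| >= a (i + 1)]. The bound holds
    for all [N] at once, as dominated summation requires. *)
Lemma lattice_sum_le (a : R) : 0 < a -> badly_approximable a ->
  exists (A : nat -> R) (B : R), (forall M, \sum_(m < M) A m <= B) /\
    forall m N, (0 < m)%N ->
    \sum_(n < N) (m%:R * `|m%:R ^+ 2 - a ^+ 2 * n.+1%:R ^+ 2|)^-1 <= A m.
Proof.
move=> a0 ba; pose n0 m := Num.truncn (m%:R / a : R).
have [B1 HB1] := near_sum_le n0 a0 ba.
have [B2 HB2] := near_sum_le (fun m => (n0 m).+1) a0 ba.
have [C C0 HC] : exists2 C : R, 0 <= C & (a * Num.sqrt a)^-1 = C.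
  by eexists; last reflexivity; rewrite invr_ge0 mulr_ge0 ?sqrtr_ge0// ltW.
exists (fun m => (m%:R ^+ 2 * `|m%:R - a * (n0 m)%:R|)^-1 +
  (m%:R ^+ 2 * `|m%:R - a * (n0 m).+1%:R|)^-1 +
  (6 * C) * (m%:R * Num.sqrt m%:R)^-1), (B1 + B2 + 6 * C * 3); split=> [M|m N m0].
  rewrite !big_split /= -mulr_sumr; apply: lerD; first exact: lerD (HB1 M) (HB2 M).
  rewrite ler_wpM2l ?mulr_ge0//; case: M => [|M]; first by rewrite big_ord0.
  by rewrite big_ord_recl mul0r invr0 add0r; exact: sum_inv_sqrt_le.
have mR : 0 < m%:R :> R by rewrite ltr0n.
have /truncn_itv/andP[] : 0 <= m%:R / a by rewrite divr_ge0// ltW.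
rewrite -/(n0 m) ler_pdivlMr// ltr_pdivrMr// => n0m mn0.
pose T n := (m%:R * `|m%:R ^+ 2 - a ^+ 2 * n%:R ^+ 2|)^-1.
have T0 n : 0 <= T n by rewrite invr_ge0 mulr_ge0.
have rpos n : 0 < `|m%:R - a * n%:R|.
  by rewrite normr_gt0; exact: badly_approximable_neq.
have D0 : 0 <= (m%:R * Num.sqrt m%:R)^-1 :> R by rewrite invr_ge0 mulr_ge0.
have far (f : nat -> nat) K : (forall i, (i < K)%N ->
    a * i.+1%:R <= `|m%:R - a * (f i)%:R|) ->
    \sum_(i < K) T (f i) <= 3 * C * (m%:R * Num.sqrt m%:R)^-1.
  move=> Hf; apply: le_trans
   (_ : \sum_(i < K) ((m%:R * Num.sqrt m%:R)^-1 * C * (i.+1%:R * Num.sqrt i.+1%:R)^-1) <= _).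
    by apply: ler_sum => i _; rewrite -HC; apply: lattice_term_le (Hf i _).
  rewrite -mulr_sumr mulrC mulrAC -mulrA ler_wpM2r ?mulr_ge0//.
  exact: sum_inv_sqrt_le.
(* The range is enlarged so that it reaches past [m / a] even when [N] is small. *)
have step : \sum_(n < N) T n.+1 <= \sum_(n < (n0 m).+1 + N.+1) T n.
  apply: le_trans (_ : \sum_(n < N.+1) T n <= _).
    by rewrite big_ord_recl /= lerDr.
  rewrite addnC big_split_ord /= lerDl; exact: sumr_ge0.
apply: le_trans step _; rewrite big_split_ord /=.
have h1 : \sum_(n < (n0 m).+1) T n <= (m%:R ^+ 2 * `|m%:R - a * (n0 m)%:R|)^-1 +
    3 * C * (m%:R * Num.sqrt m%:R)^-1.
  rewrite (reindex_inj rev_ord_inj) /= big_ord_recl /= subSS subn0; apply: lerD.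
    by apply: lattice_term_near_le => //; rewrite -normr_gt0.
  apply: (far (fun i => (n0 m - i.+1)%N)) => i iK.
  have ai : 0 <= a * i.+1%:R by rewrite mulr_ge0// ltW.
  by rewrite natrB// ger0_norm; lra.
have h2 : \sum_(i < N.+1) T ((n0 m).+1 + i)%N <= (m%:R ^+ 2 * `|m%:R - a * (n0 m).+1%:R|)^-1 +
    3 * C * (m%:R * Num.sqrt m%:R)^-1.
  rewrite big_ord_recl addn0; apply: lerD.
    by apply: lattice_term_near_le => //; rewrite -normr_gt0.
  apply: (far (fun i => ((n0 m).+1 + i.+1)%N)) => i iK.
  have ai : 0 <= a * i.+1%:R by rewrite mulr_ge0// ltW.
  by rewrite natrD distrC ger0_norm; lra.
by apply: le_trans (lerD h1 h2) _; rewrite le_eqVlt; apply/orP; left; apply/eqP; ring.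
Qed.

End LatticeSum.

(** * Partial fractions of the cotangent *)

Section Cotangent.
Variable R : realType.
Implicit Types x y : R.

Definition cot x := cos x / sin x.

Lemma cotDpi x : cot (x + pi) = cot x.
Proof. by rewrite /cot cosDpi sinDpi invrN mulrNN. Qed.

Lemma cotDnpi x (z : int) : cot (x + pi * z%:~R) = cot x.
Proof.
have H n y : cot (y + pi * n%:R) = cot y.
  by elim: n => [|n IH]; rewrite ?mulr0 ?addr0// -natr1 mulrDr mulr1 addrA cotDpi.
case: z => n; first by rewrite -pmulrn H.
by rewrite NegzE rmorphN /= mulrN -[LHS](H n.+1) subrK.
Qed.

Lemma cot_dup x : 0 < x < 1 ->
  2 * cot (pi * x) = cot (pi * (x / 2)) + cot (pi * ((x + 1) / 2)).
Proof.
move=> /andP[x0 x1]; have p0 := pi_gt0 R.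
have -> : pi * ((x + 1) / 2) = pi * (x / 2) + pi / 2 :> R by field.
have -> : pi * x = pi * (x / 2) + pi * (x / 2) :> R by field.
have s0 : sin (pi * (x / 2)) != 0.
  by rewrite gt_eqF// sin_gt0_pi//; apply/andP; split; nra.
have c0 : cos (pi * (x / 2)) != 0.
  by rewrite gt_eqF// cos_gt0_pihalf//; apply/andP; split; nra.
rewrite /cot cosDpihalf sinDpihalf cosD sinD.
move: c0 s0; set c := cos _; set s := sin _ => c0 s0.
have sc : s * c + c * s != 0.
  by rewrite (_ : _ + _ = 2 * (s * c)); [rewrite !mulf_neq0 | ring].
by field; rewrite sc c0 s0.
Qed.

Lemma cvg_inv_addn x : (fun N : nat => (x + N%:R)^-1) @ \oo --> (0 : R).
Proof.
apply/cvgrPdist_le => e e0; near=> N; rewrite sub0r normrN normfV.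
have e1 : 0 < e^-1 by rewrite invr_gt0.
have hN : `|x| + e^-1 < N%:R by near: N; exact: nbhs_infty_gtr.
have hx : e^-1 <= `|x + N%:R|.
  have := ler_norm (- x); rewrite normrN => h; apply: le_trans (ler_norm _); lra.
by rewrite -[leRHS]invrK lef_pV2 ?posrE// (lt_le_trans e1).
Unshelve. all: by end_near. Qed.

Lemma cvg_inv_subn x : (fun N : nat => (x - N%:R)^-1) @ \oo --> (0 : R).
Proof.
have -> : (fun N : nat => (x - N%:R)^-1) = (fun N : nat => - (- x + N%:R)^-1).
  by apply/funext => N; rewrite -invrN opprD opprK.
by rewrite -oppr0; apply: cvgN; exact: cvg_inv_addn.
Qed.

(** Symmetric partial sums of the Mittag-Leffler series of [pi cot (pi x)]; pairing [i] with [- i]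
    makes it converge. *)
Definition cotD (N : nat) x :=
  x^-1 + \sum_(i < N) ((x + i.+1%:R)^-1 + (x - i.+1%:R)^-1).

Lemma cotDS N x :
  cotD N.+1 x = cotD N x + ((x + N.+1%:R)^-1 + (x - N.+1%:R)^-1).
Proof. by rewrite /cotD big_ord_recr /= addrA. Qed.

Lemma cotD_shift N x :
  cotD N (x + 1) = cotD N x + (x + N.+1%:R)^-1 - (x - N%:R)^-1.
Proof.
elim: N => [|N IH]; first by rewrite /cotD !big_ord0 !addr0 subr0; ring.
rewrite !cotDS IH -[N.+2%:R]natr1 -[N.+1%:R in LHS]natr1 -[N.+1%:R in RHS]natr1.
have -> : x + 1 + (N%:R + 1) = x + (N%:R + 1 + 1) by ring.
have -> : x + 1 - (N%:R + 1) = x - N%:R by ring.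
by ring.
Qed.

Lemma cotDN N x : cotD N (- x) = - cotD N x.
Proof.
rewrite /cotD invrN opprD -sumrN; congr (_ + _); apply: eq_bigr => i _.
by rewrite opprD addrC -!invrN !opprD !opprK.
Qed.

(** The two sums on the left collect the even and the odd shifts of [x]. The odd ones run from
    [- (2 N - 1)] to [2 N + 1], so the last has no partner. *)
Lemma cotD_dup N x :
  cotD N (x / 2) + cotD N ((x + 1) / 2) = 2 * (cotD N.*2 x + (x + N.*2.+1%:R)^-1).
Proof.
have half y n : (y / 2 + n%:R)^-1 = 2 * (y + n.*2%:R)^-1.
  rewrite -[in RHS](invrK 2) -invfM -muln2 natrM; congr (_^-1); by field.
have halfB y n : (y / 2 - n%:R)^-1 = 2 * (y - n.*2%:R)^-1.
  rewrite -[in RHS](invrK 2) -invfM -muln2 natrM; congr (_^-1); by field.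
elim: N => [|N IH].
  by rewrite /cotD !big_ord0 !addr0 mulrDr !invfM !invrK ![_^-1 * _]mulrC.
rewrite doubleS !cotDS addrACA IH !half !halfB doubleS.
set m := N.*2; rewrite -[m.+3%:R]natr1 -[m.+2%:R]natr1 -[m.+1%:R]natr1.
have -> : x + 1 + (m%:R + 1 + 1) = x + (m%:R + 1 + 1 + 1) by ring.
have -> : x + 1 - (m%:R + 1 + 1) = x - (m%:R + 1) by ring.
by ring.
Qed.

Lemma cvg_sum_inv_sq (u : nat -> R) (C : R) :
  (forall i, `|u i| <= C / i.+1%:R ^+ 2) -> cvgn (fun N => \sum_(i < N) u i).
Proof.
move=> uC; have C0 : 0 <= C.
  by have := le_trans (normr_ge0 _) (uC 0%N); rewrite expr1n divr1.
apply: (@cvg_abs_sum _ _ (C * 2)) => N.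
apply: (@le_trans _ _ (\sum_(i < N) (C / i.+1%:R ^+ 2))); first exact: ler_sum.
by rewrite -mulr_sumr ler_wpM2l// sum_inv_sq_le.
Qed.

Lemma is_cvg_cotD x : 0 < x < 1 -> cvgn (cotD^~ x).
Proof.
move=> /andP[x0 x1]; apply: is_cvgD; first exact: is_cvg_cst.
apply: (@cvg_sum_inv_sq (fun i => (x + i.+1%:R)^-1 + (x - i.+1%:R)^-1)
  (2 / (1 - x ^+ 2))) => i.
have n1 : 1 <= i.+1%:R :> R by rewrite ler1n.
move: n1; move: (i.+1%:R : R) => n n1.
have -> : (x + n)^-1 + (x - n)^-1 = - (2 * x / (n ^+ 2 - x ^+ 2)).
  by field; apply/and3P; split; [nra|lra|lra].
rewrite normrN ger0_norm; last by rewrite divr_ge0//; nra.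
have h1 : 0 < n ^+ 2 - x ^+ 2 by nra.
have h2 : 0 < 1 - x ^+ 2 by nra.
rewrite ler_pdivrMr// mulrAC ler_pdivlMr ?exprn_gt0//; last lra.
rewrite [leRHS]mulrAC ler_pdivlMr//.
have h3 : 0 <= (n ^+ 2 - 1) * x ^+ 2 by rewrite mulr_ge0 ?sqr_ge0//; nra.
have h4 : 0 <= (1 - x) * (n ^+ 2 * (1 - x ^+ 2)).
  by rewrite !mulr_ge0 ?sqr_ge0//; lra.
lra.
Qed.

(** * Bounds for the sine and for the regular part of the cotangent *)

Lemma sin_le_id x : 0 <= x -> sin x <= x.
Proof.
move=> x0; have [|c _] := @MVT_segment R sin cos 0 x x0.
  by apply: continuous_subspaceT => ?; exact: continuous_sin.
rewrite sin0 !subr0 => ->; rewrite ler_piMl//; exact: cos_le1.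
Qed.

Lemma cos_ge_sq x : 0 <= x -> 1 - x ^+ 2 / 2 <= cos x.
Proof.
move=> x0; have -> : x = (x / 2) *+ 2 by rewrite mulr2n; field.
rewrite cos_mulr2n cos2sin2.
have h := sin_le_id (divr_ge0 x0 (ler0n R 2)).
have h' : - (x / 2) <= sin (x / 2).
  have [|c _] := @MVT_segment R sin cos 0 (x / 2) (divr_ge0 x0 (ler0n R 2)).
    by apply: continuous_subspaceT => ?; exact: continuous_sin.
  rewrite sin0 !subr0 => ->; have := cos_geN1 c; nra.
have : sin (x / 2) ^+ 2 <= (x / 2) ^+ 2 by nra.
have -> : (x / 2 *+ 2) ^+ 2 / 2 = 2 * (x / 2) ^+ 2 by rewrite mulr2n; field.
rewrite !mulr2n; lra.
Qed.

Lemma sin_ge_cube x : 0 < x -> x - x ^+ 3 / 2 <= sin x.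
Proof.
move=> x0; have [|c] := @MVT R sin cos 0 x x0.
  by apply: continuous_subspaceT => ?; exact: continuous_sin.
rewrite in_itv /= sin0 !subr0 => /andP[c0 cx] ->.
have := cos_ge_sq (ltW c0); have : c ^+ 2 <= x ^+ 2 by nra.
have -> : x - x ^+ 3 / 2 = (1 - x ^+ 2 / 2) * x by ring.
by move=> h1 h2; rewrite ler_pM2r//; lra.
Qed.

Lemma sin_ge_quarter x : 0 < x <= pi / 2 -> x / 4 <= sin x.
Proof.
move=> /andP[x0 xp]; have := pihalf_lt2 R => p2; have [x1|x1] := leP x 1.
  have := sin_ge_cube x0; nra.
apply: le_trans (_ : sin 1 <= _).
  have := sin_ge_cube (@ltr01 R); lra.
by rewrite leNgt ltr_sin ?in_itv /= -?leNgt; [exact: ltW | apply/andP; split; lra..].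
Qed.

(** With [u = pi x] and [s = sin u], [u^2 - s^2 <= (u^3 / 2) (2 u) = u^4], while [s >= u / 4] bounds
    the denominator [s^2 u^2] below by [u^4 / 16]. *)
Lemma inv_sin_sq_bound x : 0 < x <= 2^-1 ->
  `|x ^- 2 - pi ^+ 2 / sin (pi * x) ^+ 2| <= 16 * pi ^+ 2.
Proof.
move=> /andP[x0 x1]; have p0 := pi_gt0 R; have u0 : 0 < pi * x by rewrite mulr_gt0.
have uE : pi * x <= pi / 2 by rewrite ler_pM2l.
have h1 := sin_ge_quarter (introT andP (conj u0 uE)).
have h2 := sin_le_id (ltW u0); have h3 := sin_ge_cube u0.
have -> : x ^- 2 = pi ^+ 2 / (pi * x) ^+ 2.
  by rewrite -expr_div_n [in RHS]invfM mulrA divff ?gt_eqF// mul1r exprVn.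
move: u0 h1 h2 h3; move: (pi * x) (sin _) => u s u0 h1 h2 h3.
have s0 : 0 < s by lra.
rewrite -mulrBr normrM (ger0_norm (sqr_ge0 pi)) [leRHS]mulrC ler_pM2l ?exprn_gt0//.
have -> : u ^- 2 - s ^- 2 = - ((u - s) * (u + s) / (s ^+ 2 * u ^+ 2)).
  by field; rewrite !gt_eqF.
rewrite normrN ger0_norm; last by rewrite divr_ge0 ?mulr_ge0 ?exprn_ge0//; lra.
rewrite ler_pdivrMr ?mulr_gt0 ?exprn_gt0//.
apply: le_trans (_ : (u ^+ 3 / 2) * (2 * u) <= _).
  by apply: ler_pM; lra.
have -> : u ^+ 3 / 2 * (2 * u) = (u ^+ 2) * u ^+ 2 by field.
rewrite [leRHS]mulrA ler_pM2r ?exprn_gt0//.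
have -> : 16 * s ^+ 2 = (4 * s) ^+ 2 by ring.
by rewrite ler_sqr ?nnegrE; lra.
Qed.

(** Subtracting the poles at both ends of [(0, 1)] leaves a function with bounded derivative
    there. *)
Definition cotR x := pi * cot (pi * x) - x^-1 - (x - 1)^-1.

Definition cotR' x := - (pi ^+ 2 / sin (pi * x) ^+ 2) + x ^- 2 + (x - 1) ^- 2.

Lemma is_derive_cotR x : 0 < x < 1 -> is_derive x 1 cotR (cotR' x).
Proof.
move=> /andP[x0 x1]; have p0 := pi_gt0 R.
have s0 : sin (pi * x) != 0.
  by rewrite gt_eqF// sin_gt0_pi//; apply/andP; split; nra.
have xn0 : x != 0 by rewrite gt_eqF.
have xn1 : x - 1 != 0 by rewrite lt_eqF//; lra.
have d1 : is_derive x 1 (fun y : R => pi * y) pi.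
  by have := is_deriveZ pi (@is_derive_id R R x 1); rewrite scaler1.
have dc := is_derive1_comp (is_derive_cos (pi * x)) d1.
have ds := is_derive1_comp (is_derive_sin (pi * x)) d1.
have dV := @is_deriveV _ _ _ _ _ s0 ds.
have dcot := is_deriveZ pi (is_deriveM dc dV).
have di := @is_deriveV _ _ _ _ _ xn0 (is_derive_id x 1).
have d2' : is_derive x 1 (fun y : R => y - 1) (1 - 0) by apply: is_deriveB.
have d2 := @is_deriveV R (fun y => y - 1) x (1 - 0) 1 xn1 d2'.
have E : pi *: ((cos \o *%R pi) x *: (- (sin \o *%R pi) x ^- 2 *: (cos (pi * x) * pi)) +
   ((sin \o *%R pi) x)^-1 *: (- sin (pi * x) * pi)) - (- x ^- 2 *: 1) -
   (- (x - 1) ^- 2 *: (1 - 0)) = cotR' x :> R.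
  rewrite /cotR' /GRing.scale /=.
  rewrite [in RHS](_ : pi ^+ 2 = pi ^+ 2 * (cos (pi * x) ^+ 2 + sin (pi * x) ^+ 2));
    last by rewrite cos2Dsin2 mulr1.
  by field; rewrite s0 xn0 xn1.
rewrite -E; exact: (is_deriveB (is_deriveB dcot di) d2).
Qed.

Lemma cotR'_bound x : 0 < x < 1 -> `|cotR' x| <= 16 * pi ^+ 2 + 4.
Proof.
move=> /andP[x0 x1].
(* [cotR'] is symmetric about [1 / 2], so only the pole at [0] needs care; away from it
   [1 / (x - 1)^2 <= 4]. *)
wlog xh : x x0 x1 / x <= 2^-1.
  move=> H; have [/H|xh] := leP x 2^-1; first exact.
  have := H (1 - x); rewrite /cotR'.
  have -> : sin (pi * (1 - x)) = sin (pi * x).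
    rewrite mulrBr mulr1 addrC sinDpi sinN opprK//.
  have -> : (1 - x - 1) ^- 2 = x ^- 2 by rewrite addrAC subrr add0r sqrrN.
  have -> : (1 - x) ^- 2 = (x - 1) ^- 2 by rewrite -sqrrN opprB.
  rewrite addrAC; apply; lra.
have := inv_sin_sq_bound (introT andP (conj x0 xh)).
have : `|(x - 1) ^- 2| <= 4.
  rewrite ger0_norm ?invr_ge0 ?sqr_ge0// -[leRHS]invrK lef_pV2 ?posrE//; nra.
rewrite /cotR' [- _ + _]addrC => h1 h2.
by apply: le_trans (ler_normD _ _) _; exact: lerD.
Qed.

Lemma cotR_lipschitz x y : 0 < x < 1 -> 0 < y < 1 ->
  `|cotR x - cotR y| <= (16 * pi ^+ 2 + 4) * `|x - y|.
Proof.
wlog xy : x y / y <= x.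
  move=> H hx hy; have [/H|/ltW /H] := leP y x; first exact.
  by rewrite distrC (distrC x); exact.
move=> /andP[x0 x1] /andP[y0 y1].
have d z : z \in `[y, x] -> is_derive z 1 cotR (cotR' z).
  by rewrite in_itv /= => /andP[? ?]; apply: is_derive_cotR; apply/andP; split; lra.
have d' z : z \in `]y, x[ -> is_derive z 1 cotR (cotR' z).
  by rewrite in_itv /= => /andP[? ?]; apply: d; rewrite in_itv /= !ltW.
have cont : {within `[y, x], continuous cotR}.
  by apply: derivable_within_continuous => z zi; have [] := d z zi.
have [c] := @MVT_segment R cotR cotR' y x xy d' cont.
rewrite in_itv /= => /andP[? ?] ->.
by rewrite normrM ler_wpM2r// cotR'_bound//; apply/andP; split; lra.
Qed.

(** The remaining poles [-1] and [i + 2], [- (i + 2)] have distance at least [1] and [i + 1] from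
    [(0, 1)]. The pole [-1] contributes [1] to the constant, the pairs twice the bound [2] for the
    sum of inverse squares. *)
Lemma cotD_rest_lipschitz N x y : 0 < x < 1 -> 0 < y < 1 ->
  `|(cotD N.+1 x - x^-1 - (x - 1)^-1) - (cotD N.+1 y - y^-1 - (y - 1)^-1)|
    <= 5 * `|x - y|.
Proof.
move=> hx hy.
have E z : cotD N.+1 z - z^-1 - (z - 1)^-1 =
    (z + 1)^-1 + \sum_(i < N) ((z + i.+2%:R)^-1 + (z - i.+2%:R)^-1).
  by rewrite /cotD big_ord_recl /=; ring.
rewrite !E opprD addrACA -sumrB.
case/andP: hx => x0 x1; case/andP: hy => y0 y1.
have inv_lip (a b m : R) : 0 < m -> m <= `|a| -> m <= `|b| -> `|a - b| = `|x - y| ->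
    `|a^-1 - b^-1| <= `|x - y| * m ^- 2.
  move=> m0 ma mb <-.
  have a0 : a != 0 by rewrite -normr_gt0; lra.
  have b0 : b != 0 by rewrite -normr_gt0; lra.
  have -> : a^-1 - b^-1 = - ((a - b) * (a * b)^-1) by field; rewrite a0 b0.
  rewrite normrN normrM normfV ler_wpM2l// lef_pV2 ?posrE ?exprn_gt0 ?normr_gt0 ?mulf_neq0//.
  by rewrite normrM expr2 ler_pM// ltW.
have h1 : `|(x + 1)^-1 - (y + 1)^-1| <= `|x - y|.
  apply: le_trans (inv_lip _ _ 1 _ _ _ _) _ => //.
  - by rewrite ger0_norm; lra.
  - by rewrite ger0_norm; lra.
  - by congr (`|_|); ring.
  - by rewrite expr1n invr1 mulr1.
apply: le_trans (ler_normD _ _) _.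
have -> : 5 * `|x - y| = `|x - y| + `|x - y| * (2 * 2) by ring.
apply: lerD => //; apply: le_trans (ler_norm_sum _ _ _) _.
apply: le_trans (_ : \sum_(i < N) (`|x - y| * (2 * i.+1%:R ^- 2)) <= _); last first.
  by rewrite -mulr_sumr ler_wpM2l// -mulr_sumr ler_wpM2l// sum_inv_sq_le.
apply: ler_sum => i _.
rewrite (_ : _ - _ = ((x + i.+2%:R)^-1 - (y + i.+2%:R)^-1) +
  ((x - i.+2%:R)^-1 - (y - i.+2%:R)^-1)); last by ring.
apply: le_trans (ler_normD _ _) _.
have -> : `|x - y| * (2 * i.+1%:R ^- 2) =
  `|x - y| * i.+1%:R ^- 2 + `|x - y| * i.+1%:R ^- 2 by ring.
have i0 : 0 < i.+1%:R :> R by [].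
rewrite -[i.+2%:R]natr1; move: (i.+1%:R : R) i0 => n n0.
apply: lerD; apply: inv_lip => //.
- by rewrite ger0_norm; lra.
- by rewrite ger0_norm; lra.
- by congr (`|_|); ring.
- by rewrite ler0_norm; lra.
- by rewrite ler0_norm; lra.
- by congr (`|_|); ring.
Qed.

(** The defect of the partial fraction expansion, to be shown zero by Herglotz's trick: both of its
    terms satisfy the same duplication formula and have the same poles. *)
Definition cotG x := pi * cot (pi * x) - limn (cotD^~ x).

Lemma cotG_lipschitz x y : 0 < x < 1 -> 0 < y < 1 ->
  `|cotG x - cotG y| <= (16 * pi ^+ 2 + 9) * `|x - y|.
Proof.
move=> hx hy; have cx := is_cvg_cotD hx; have cy := is_cvg_cotD hy.
have h2 : `|(limn (cotD^~ x) - x^-1 - (x - 1)^-1) -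
   (limn (cotD^~ y) - y^-1 - (y - 1)^-1)| <= 5 * `|x - y|.
  apply: (@cvgr_to_le _ (nbhs \oo) _ _ (fun N => `|(cotD N.+1 x - x^-1 - (x - 1)^-1) -
    (cotD N.+1 y - y^-1 - (y - 1)^-1)|)); last first.
    by near=> N; exact: cotD_rest_lipschitz.
  have cS z : cvgn (cotD^~ z) -> (fun N => cotD N.+1 z) @ \oo --> limn (cotD^~ z).
    by move=> cz; rewrite (cvg_shiftS (cotD^~ z)).
  apply: cvg_norm; apply: cvgB; (apply: cvgB; last exact: cvg_cst);
   (apply: cvgB; last exact: cvg_cst); exact: cS.
have h1 := cotR_lipschitz hx hy.
have -> : cotG x - cotG y = (cotR x - cotR y) - ((limn (cotD^~ x) - x^-1 - (x - 1)^-1) -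
   (limn (cotD^~ y) - y^-1 - (y - 1)^-1)) by rewrite /cotG /cotR; ring.
apply: le_trans (ler_normB _ _) _.
apply: le_trans (lerD h1 h2) _.
by rewrite -mulrDl ler_wpM2r//; lra.
Unshelve. all: by end_near. Qed.

Lemma cotG_dup x : 0 < x < 1 -> 2 * cotG x = cotG (x / 2) + cotG ((x + 1) / 2).
Proof.
move=> hx; have hx1 : 0 < x / 2 < 1 by lra.
have hx2 : 0 < (x + 1) / 2 < 1 by lra.
have c0 := is_cvg_cotD hx; have c1 := is_cvg_cotD hx1; have c2 := is_cvg_cotD hx2.
have : limn (cotD^~ (x / 2)) + limn (cotD^~ ((x + 1) / 2)) = 2 * limn (cotD^~ x).
  apply: (@cvg_unique _ (@Rhausdorff R) ((fun N => cotD N (x / 2) + cotD N ((x + 1) / 2)) @ \oo)).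
    exact: cvgD.
  have -> : (fun N => cotD N (x / 2) + cotD N ((x + 1) / 2)) =
      (fun N => 2 * (cotD N.*2 x + (x + N.*2.+1%:R)^-1)).
    by apply/funext => N; exact: cotD_dup.
  have dbl : (fun N : nat => N.*2) @ \oo --> \oo.
    have -> : double = muln^~ 2 by apply/funext => n; rewrite muln2.
    exact: cvg_mulnr.
  apply: cvgMr; rewrite -[limn _]addr0; apply: cvgD.
    exact: (cvg_comp _ _ dbl c0).
  have hS : (fun N : nat => (x + N.+1%:R)^-1) @ \oo --> (0 : R).
    by rewrite (cvg_shiftS (fun N : nat => (x + N%:R)^-1)); exact: cvg_inv_addn.
  exact: (cvg_comp _ _ dbl hS).
by rewrite /cotG mulrBr mulrCA cot_dup// => <-; ring.
Qed.

(* [cotG] is Lipschitz on [(0, 1)], and [cotG_dup] halves its Lipschitz constant. *)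
Lemma cotG_const x y : 0 < x < 1 -> 0 < y < 1 -> cotG x = cotG y.
Proof.
move=> hx hy; pose K : R := 16 * pi ^+ 2 + 9.
have K0 : 0 <= K by rewrite addr_ge0// mulr_ge0// sqr_ge0.
have H n : forall x y, 0 < x < 1 -> 0 < y < 1 ->
    2 ^+ n * `|cotG x - cotG y| <= K * `|x - y|.
  elim: n => [|n IH] {hx hy}x {}y hx hy.
    by rewrite expr0 mul1r; exact: cotG_lipschitz.
  have := IH (x / 2) (y / 2); have := IH ((x + 1) / 2) ((y + 1) / 2).
  have -> : `|(x + 1) / 2 - (y + 1) / 2| = `|x - y| / 2.
    by rewrite -[in RHS](ger0_norm (ler0n R 2)) -normf_div; congr (`|_|); field.
  have -> : `|x / 2 - y / 2| = `|x - y| / 2.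
    by rewrite -[in RHS](ger0_norm (ler0n R 2)) -normf_div; congr (`|_|); field.
  move=> /(_ ltac:(lra) ltac:(lra)) h1 /(_ ltac:(lra) ltac:(lra)) h2.
  have := cotG_dup hx; have := cotG_dup hy => ey ex.
  have -> : 2 ^+ n.+1 * `|cotG x - cotG y| = 2 ^+ n * `|2 * cotG x - 2 * cotG y|.
    by rewrite -mulrBr normrM ger0_norm// exprSr mulrA.
  rewrite ex ey opprD addrACA.
  apply: le_trans (ler_wpM2l (exprn_ge0 _ (ler0n R 2)) (ler_normD _ _)) _.
  by rewrite mulrDr; lra.
apply/eqP; rewrite -subr_eq0 -normr_eq0; apply/negPn/negP => e0.
have {}e0 : 0 < `|cotG x - cotG y| by rewrite lt0r e0 normr_ge0.
have C0 : 0 <= K * `|x - y| / `|cotG x - cotG y| by rewrite divr_ge0// mulr_ge0.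
have /andP[_] := truncn_itv C0; rewrite ltr_pdivrMr// => h.
have := le_lt_trans (H (Num.truncn (K * `|x - y| / `|cotG x - cotG y|)).+1 x y hx hy) h.
rewrite ltr_pM2r// -natrX ltr_nat; apply/negP; rewrite -leqNgt; exact/ltnW/ltn_expl.
Qed.

(** The constant value of [cotG] is read off at [1 / 2]: there the cotangent vanishes, and oddness
    with the shift formula gives [cotD N (1 / 2) = 1 / (1 / 2 + N)]. *)
Lemma cvg_cotD01 x : 0 < x < 1 -> cotD^~ x @ \oo --> pi * cot (pi * x).
Proof.
move=> hx; have h2 : 0 < (2^-1 : R) < 1 by apply/andP; split; lra.
have c2 : cotD^~ (2^-1 : R) @ \oo --> (0 : R).
  have -> : cotD^~ (2^-1 : R) = (fun N : nat => (2^-1 + N%:R)^-1).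
    apply/funext => N; have := cotD_shift N (- 2^-1); rewrite cotDN.
    have -> : - 2^-1 + 1 = 2^-1 :> R by field.
    rewrite -opprD invrN opprK -[N.+1%:R]natr1 (addrC (2^-1) N%:R).
    have -> : - 2^-1 + (N%:R + 1) = N%:R + 2^-1 :> R by field.
    move=> ?; lra.
  exact: cvg_inv_addn.
have := cotG_const hx h2; rewrite /cotG (cvg_lim _ c2)//.
rewrite /cot cos_pihalf mul0r mulr0 subr0 => /eqP; rewrite subr_eq0 => /eqP ->.
exact: is_cvg_cotD.
Qed.

Lemma cvg_cotD x : (forall z : int, x != z%:~R) ->
  cotD^~ x @ \oo --> pi * cot (pi * x).
Proof.
move=> xz.
have Hl y : (fun N : nat => (y + N.+1%:R)^-1 - (y - N%:R)^-1) @ \oo --> (0 : R).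
  rewrite -[0]subr0; apply: cvgB; last exact: cvg_inv_subn.
  by rewrite (cvg_shiftS (fun N : nat => (y + N%:R)^-1)); exact: cvg_inv_addn.
have cS y : cot (pi * (y + 1)) = cot (pi * y) by rewrite mulrDr mulr1 cotDpi.
have up y : cotD^~ y @ \oo --> pi * cot (pi * y) ->
    cotD^~ (y + 1) @ \oo --> pi * cot (pi * (y + 1)).
  move=> h; rewrite cS.
  have -> : cotD^~ (y + 1) = (fun N => cotD N y + ((y + N.+1%:R)^-1 - (y - N%:R)^-1)).
    by apply/funext => N; rewrite cotD_shift addrA.
  by rewrite -[X in _ --> X]addr0; apply: cvgD h (Hl y).
have down y : cotD^~ (y + 1) @ \oo --> pi * cot (pi * (y + 1)) ->
    cotD^~ y @ \oo --> pi * cot (pi * y).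
  move=> h; rewrite -cS.
  have -> : cotD^~ y = (fun N => cotD N (y + 1) - ((y + N.+1%:R)^-1 - (y - N%:R)^-1)).
    by apply/funext => N; rewrite cotD_shift; ring.
  by rewrite -[X in _ --> X]subr0; apply: cvgB h (Hl y).
have x01 : 0 < x - (Num.floor x)%:~R < 1.
  have /andP[h1 h2] := floor_itv x.
  rewrite subr_gt0 lt_neqAle eq_sym xz h1 /= ltrBlDl; by rewrite intrD in h2.
move: (cvg_cotD01 x01); move: (Num.floor x) => z.
have upn y n : cotD^~ y @ \oo --> pi * cot (pi * y) ->
    cotD^~ (y + n%:R) @ \oo --> pi * cot (pi * (y + n%:R)).
  by elim: n => [|n IH] h; rewrite ?addr0// -natr1 addrA; apply: up; exact: IH.
have downn y n : cotD^~ (y + n%:R) @ \oo --> pi * cot (pi * (y + n%:R)) ->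
    cotD^~ y @ \oo --> pi * cot (pi * y).
  by elim: n => [|n IH] h; [rewrite addr0 in h | apply: IH; apply: down; rewrite -addrA natr1].
case: z => n.
  by rewrite -pmulrn => /(upn _ n); rewrite subrK.
by rewrite NegzE rmorphN /= opprK -pmulrn; exact: downn.
Qed.

End Cotangent.

(** * Partial fractions of the secant *)

Section Secant.
Variable R : realType.
Implicit Types x y a : R.

Lemma sin_pi_neq0 x : (forall z : int, x != z%:~R) -> sin (pi * x) != 0.
Proof.
move=> xz; have H n y : sin (y + pi * n%:R) ^+ 2 = sin y ^+ 2.
  elim: n => [|n IH]; rewrite ?mulr0 ?addr0//.
  by rewrite -natr1 mulrDr mulr1 addrA sinDpi sqrrN.
have x01 : 0 < pi * (x - (Num.floor x)%:~R) < pi.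
  have /andP[h1 h2] := floor_itv x; have p0 := pi_gt0 R.
  have h3 : 0 < x - (Num.floor x)%:~R by rewrite subr_gt0 lt_neqAle eq_sym xz.
  have h4 : x - (Num.floor x)%:~R < 1 by rewrite ltrBlDl; rewrite intrD in h2.
  by apply/andP; split; nra.
have := sin_gt0_pi x01; rewrite mulrBr; move: (Num.floor x) => z s0.
rewrite -sqrf_eq0.
suff -> : sin (pi * x) ^+ 2 = sin (pi * x - pi * z%:~R) ^+ 2.
  by rewrite sqrf_eq0 gt_eqF.
case: z {s0 x01} => n; first by rewrite -pmulrn -[RHS](H n) subrK.
by rewrite NegzE rmorphN /= mulrN opprK -pmulrn H.
Qed.

(** The two angles have sum [pi / 2] and difference [pi x / 2], so
    [cot u + cot v = 1 / (sin u sin v)] and [2 sin u sin v = cos (pi x / 2)]. *)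
Lemma sec_cot x : sin (pi * ((1 - x) / 4)) != 0 -> sin (pi * ((1 + x) / 4)) != 0 ->
  sec (pi * x / 2) = 2^-1 * (cot (pi * ((1 - x) / 4)) + cot (pi * ((1 + x) / 4))).
Proof.
set u := pi * ((1 - x) / 4); set v := pi * ((1 + x) / 4) => su sv.
have uv : u + v = pi / 2 by rewrite /u /v; field.
have vu : v - u = pi * x / 2 by rewrite /u /v; field.
have E1 : sin u * cos v + cos u * sin v = 1 by rewrite -sinD uv sin_pihalf.
have E2 : cos u * cos v - sin u * sin v = 0 by rewrite -cosD uv cos_pihalf.
have E3 : cos (pi * x / 2) = 2 * (sin u * sin v).
  rewrite -vu cosB; lra.
have -> : cot u + cot v = (sin u * cos v + cos u * sin v) / (sin u * sin v).
  by rewrite /cot; field; rewrite su sv.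
by rewrite E1 /sec E3; field; rewrite su sv.
Qed.

Definition odd_nat (l : nat) : R := l.*2.+1%:R.

Lemma odd_nat_ge1 l : 1 <= odd_nat l.
Proof. by rewrite ler1n. Qed.

Lemma odd_nat_gt0 l : 0 < odd_nat l.
Proof. by rewrite ltr0n. Qed.

Lemma odd_nat_ge l : l.+1%:R <= odd_nat l.
Proof. rewrite ler_nat ltnS -addnn; exact: leq_addr. Qed.

Definition sgn (l : nat) : R := (-1) ^+ l.

Lemma sgn_norm l : `|sgn l| = 1.
Proof. by rewrite normrX normrN1 expr1n. Qed.

Definition not_odd x := forall l, odd_nat l ^+ 2 - x ^+ 2 != 0.

Lemma not_oddN x : not_odd x -> not_odd (- x).
Proof. by move=> h l; rewrite sqrrN. Qed.

Lemma not_odd_quarter x : not_odd x -> forall z : int, (1 + x) / 4 != z%:~R.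
Proof.
move=> xo z; apply/eqP => E; have {}E : x = (4 * z - 1)%:~R.
  by rewrite rmorphB rmorphM /= -E; field.
have := xo (`|(4 * z - 1)%R|%N)./2.
have -> : odd_nat (`|(4 * z - 1)%R|%N)./2 = `|(4 * z - 1)%R|%N%:R.
  by rewrite /odd_nat; congr (_%:R); lia.
by rewrite natr_absz E intr_norm real_normK ?num_real// subrr eqxx.
Qed.

(** Positive shifts produce the odd numbers [1, 5, ..., 4 N + 1] with sign [+], negative shifts
    [3, 7, ..., 4 N - 1] with sign [-]: altogether [2 N + 1] of them. *)
Lemma cotD_quarter N x : not_odd x ->
  cotD N ((1 - x) / 4) + cotD N ((1 + x) / 4) =
  8 * \sum_(l < N.*2.+1) (sgn l * (odd_nat l / (odd_nat l ^+ 2 - x ^+ 2))).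
Proof.
move=> xo; have nz l : odd_nat l - x != 0 /\ odd_nat l + x != 0.
  by have := xo l; rewrite subr_sqr mulf_eq0 => /norP.
have T l : odd_nat l / (odd_nat l ^+ 2 - x ^+ 2) =
    2^-1 * ((odd_nat l - x)^-1 + (odd_nat l + x)^-1).
  have [] := nz l; rewrite subr_sqr; move: (odd_nat l) => m h1 h2.
  by field; rewrite h1 h2.
elim: N => [|N IH].
  rewrite /cotD !big_ord0 !addr0 big_ord_recl big_ord0 addr0 T /sgn expr0 mul1r.
  have [] := nz 0%N; rewrite -[odd_nat 0]/(1 : R) => h1 h2.
  by rewrite !invf_div; field; rewrite h1 h2.
rewrite doubleS 2!big_ord_recr /= !mulrDr -IH !T !cotDS.
have -> : sgn (N.*2).+1 = -1 by rewrite /sgn exprS -mul2n exprM sqrrN !expr1n mulr1.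
have -> : sgn (N.*2).+2 = 1 by rewrite /sgn !exprS -mul2n exprM sqrrN !expr1n mulr1 mulN1r opprK.
have e1 (p : nat) y : ((1 + y) / 4 + p%:R)^-1 = 4 * ((4 * p).+1%:R + y)^-1.
  rewrite -[in RHS](invrK 4) -invfM -[(4 * p).+1%:R]natr1 natrM; congr (_^-1); by field.
have e2 (p : nat) y : ((1 + y) / 4 - p.+1%:R)^-1 = - (4 * ((4 * p).+3%:R - y)^-1).
  rewrite -[in RHS](invrK 4) -invfM -invrN -[p.+1%:R]natr1.
  rewrite -[(4 * p).+3%:R]natr1 -[(4 * p).+2%:R]natr1 -[(4 * p).+1%:R]natr1.
  rewrite natrM; congr (_^-1); by field.
rewrite !e1 !e2 opprK.
have [h1 h2] := nz N.*2.+1; have [h3 h4] := nz N.*2.+2.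
have e3 : odd_nat N.*2.+1 = (4 * N).+3%:R by rewrite /odd_nat; congr (_%:R); lia.
have e4 : odd_nat N.*2.+2 = (4 * N.+1).+1%:R by rewrite /odd_nat; congr (_%:R); lia.
rewrite e3 e4 in h1 h2 h3 h4 *.
move: h1 h2 h3 h4; move: ((4 * N).+3%:R : R) ((4 * N.+1).+1%:R : R) => p q h1 h2 h3 h4.
by field; rewrite h1 h2 h3 h4.
Qed.

Lemma cvg_sum_inv_sq_near (u : nat -> R) (C : R) L :
  (forall i, (L <= i)%N -> `|u i| <= C / i.+1%:R ^+ 2) ->
  cvgn (fun N => \sum_(i < N) u i).
Proof.
move=> H; pose C' := `|C| + \sum_(i < L) (`|u i| * i.+1%:R ^+ 2).
have S0 : 0 <= \sum_(i < L) (`|u i| * i.+1%:R ^+ 2).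
  by apply: sumr_ge0 => i _; rewrite mulr_ge0 ?sqr_ge0.
apply: (@cvg_sum_inv_sq _ _ C') => i; have i0 : 0 < i.+1%:R ^+ 2 :> R by rewrite exprn_gt0.
have [Li|iL] := leqP L i.
  apply: le_trans (H i Li) _; rewrite ler_pM2r ?invr_gt0// /C'.
  by have := ler_norm C; lra.
rewrite ler_pdivlMr// /C' (bigD1 (Ordinal iL)) //=.
have : 0 <= \sum_(j < L | j != Ordinal iL) (`|u j| * j.+1%:R ^+ 2).
  by apply: sumr_ge0 => j _; rewrite mulr_ge0 ?sqr_ge0.
have := normr_ge0 C; lra.
Qed.

(** The term [mu / (mu^2 - x^2)] of the secant expansion minus the Leibniz term [1 / mu], with the
    common sign; the difference decays like [mu^(-3)]. *)
Definition sec_term x l := sgn l * (x ^+ 2 / (odd_nat l * (odd_nat l ^+ 2 - x ^+ 2))).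

Lemma sec_termE x l : not_odd x ->
  sec_term x l = sgn l * (odd_nat l / (odd_nat l ^+ 2 - x ^+ 2)) - sgn l / odd_nat l.
Proof.
move=> xo; have h4 := xo l; have h3 : odd_nat l != 0 by rewrite gt_eqF// odd_nat_gt0.
rewrite /sec_term; move: (odd_nat l) (sgn l) h3 h4 => m t h3 h4.
by field; rewrite h3 h4.
Qed.

Lemma is_cvg_sec_term x : cvgn (fun N => \sum_(l < N) sec_term x l).
Proof.
apply: (@cvg_sum_inv_sq_near (sec_term x) (2 * x ^+ 2) (Num.truncn (2 * `|x|))) => l.
have x2 : 0 <= 2 * `|x| by rewrite mulr_ge0.
have /andP[_ h] := truncn_itv x2 => Ll.
have hm : 2 * `|x| <= odd_nat l.
  apply: le_trans (odd_nat_ge l); apply: le_trans (ltW h) _.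
  by rewrite ler_nat.
have m1 := odd_nat_ge1 l; have ml := odd_nat_ge l.
have xx : `|x| ^+ 2 = x ^+ 2 by rewrite real_normK ?num_real.
have x0 := normr_ge0 x.
have h1 : odd_nat l ^+ 2 <= 2 * (odd_nat l ^+ 2 - x ^+ 2) by rewrite -xx; nra.
have h2 : l.+1%:R ^+ 2 <= odd_nat l ^+ 2 by rewrite ler_sqr ?nnegrE//; lra.
have l0 : 0 < l.+1%:R ^+ 2 :> R by rewrite exprn_gt0.
rewrite normrM sgn_norm mul1r; move: m1 h1 h2 l0 {hm h ml Ll}.
move: (odd_nat l) (l.+1%:R ^+ 2 : R) => m q m1 h1 h2 q0.
have d0 : 0 < m ^+ 2 - x ^+ 2 by nra.
rewrite ger0_norm; last by rewrite divr_ge0 ?sqr_ge0// mulr_ge0//; lra.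
rewrite ler_pdivrMr; last by rewrite mulr_gt0//; lra.
rewrite mulrAC ler_pdivlMr//.
have : 0 <= x ^+ 2 by exact: sqr_ge0.
move: (x ^+ 2) d0 h1 {xx} => y d0 h1 y0.
have : q <= 2 * (m * (m ^+ 2 - y)) by nra.
nra.
Qed.

Lemma double_succ_cvg : (fun N : nat => N.*2.+1) @ \oo --> \oo.
Proof.
move=> A [n _ nA]; exists n => // N /= nN; apply: nA => /=.
by rewrite ltnW// ltnS (leq_trans nN)// -addnn leq_addr.
Qed.

Lemma cvg_quarter_sum x : not_odd x ->
  (fun N => \sum_(l < N.*2.+1) (sgn l * (odd_nat l / (odd_nat l ^+ 2 - x ^+ 2))))
  @ \oo --> pi / 4 * sec (pi * x / 2).
Proof.
move=> xo; have z1 := not_odd_quarter (not_oddN xo); have z2 := not_odd_quarter xo.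
rewrite sec_cot ?sin_pi_neq0//.
have -> : pi / 4 * (2^-1 * (cot (pi * ((1 - x) / 4)) + cot (pi * ((1 + x) / 4)))) =
   8^-1 * (pi * cot (pi * ((1 - x) / 4)) + pi * cot (pi * ((1 + x) / 4))) by field.
have -> : (fun N => \sum_(l < N.*2.+1) (sgn l * (odd_nat l / (odd_nat l ^+ 2 - x ^+ 2)))) =
   (fun N => 8^-1 * (cotD N ((1 - x) / 4) + cotD N ((1 + x) / 4))).
  by apply/funext => N; rewrite cotD_quarter// mulKf.
by apply: cvgMr; apply: cvgD; exact: cvg_cotD.
Qed.

Lemma cvg_leibniz : (fun N => \sum_(l < N.*2.+1) (sgn l / odd_nat l)) @ \oo --> (pi / 4 : R).
Proof.
have h : not_odd 0 by move=> l; rewrite expr0n subr0 sqrf_eq0 gt_eqF// odd_nat_gt0.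
have := cvg_quarter_sum h; rewrite mulr0 mul0r /sec cos0 invr1 mulr1.
set f := (X in X @ \oo --> _ -> _); suff -> : f = (fun N => \sum_(l < N.*2.+1) (sgn l / odd_nat l)) by [].
apply/funext => N; apply: eq_bigr => l _.
by rewrite expr0n subr0 expr2 invfM mulVKf// gt_eqF// odd_nat_gt0.
Qed.

(** Absolute convergence lets the limit be computed along partial sums of odd length, the only ones
    for which the secant and Leibniz expansions are available. *)
Lemma cvg_sec_term x : not_odd x ->
  (fun N => \sum_(l < N) sec_term x l) @ \oo --> pi / 4 * (sec (pi * x / 2) - 1).
Proof.
move=> xo; have c := @is_cvg_sec_term x.
suff <- : limn (fun N => \sum_(l < N) sec_term x l) = pi / 4 * (sec (pi * x / 2) - 1) by [].
apply: (@cvg_unique _ (@Rhausdorff R) ((fun N => \sum_(l < N.*2.+1) sec_term x l) @ \oo)).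
  exact: (cvg_comp _ _ double_succ_cvg c).
have -> : (fun N => \sum_(l < N.*2.+1) sec_term x l) = (fun N =>
    \sum_(l < N.*2.+1) (sgn l * (odd_nat l / (odd_nat l ^+ 2 - x ^+ 2))) -
    \sum_(l < N.*2.+1) (sgn l / odd_nat l)).
  apply/funext => N; rewrite -sumrB; apply: eq_bigr => l _; exact: sec_termE.
rewrite mulrBr mulr1; apply: cvgB; [exact: cvg_quarter_sum | exact: cvg_leibniz].
Qed.

End Secant.

(** * Even zeta values and odd beta values *)

Section Asymptotics.
Variable R : realType.
Implicit Types (f g h : R -> R) (c d : nat -> R).

(** All functions expanded here are even, so orders are counted in powers of [x^2]; the interval
    stays clear of the poles at [1]. *)
Definition bigO_sq n h := exists K : R, forall x, 0 < x -> x <= 2^-1 ->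
  `|h x| <= K * (x ^+ 2) ^+ n.

Lemma bigO_sqD n g h : bigO_sq n g -> bigO_sq n h -> bigO_sq n (fun x => g x + h x).
Proof.
move=> [K HK] [L HL]; exists (K + L) => x x0 x1; rewrite mulrDl.
by apply: le_trans (ler_normD _ _) _; rewrite lerD ?HK ?HL.
Qed.

Lemma bigO_sq_sum n k (F : nat -> R -> R) : (forall i, (i < k)%N -> bigO_sq n (F i)) ->
  bigO_sq n (fun x => \sum_(i < k) F i x).
Proof.
elim: k => [|k IH] H.
  by exists 0 => x _ _; rewrite big_ord0 normr0 mul0r.
have [||K HK] := bigO_sqD (IH _) (H k _) => //.
  by move=> i ik; apply: H; rewrite ltnS ltnW.
by exists K => x x0 x1; rewrite big_ord_recr; exact: HK.
Qed.

Lemma bigO_sqM m n g h : bigO_sq m g -> bigO_sq n h -> bigO_sq (m + n) (fun x => g x * h x).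
Proof.
move=> [K HK] [L HL]; exists (K * L) => x x0 x1.
by rewrite normrM exprD mulrACA ler_pM ?HK ?HL.
Qed.

Lemma bigO_sq_mono m (a : R) : bigO_sq m (fun x => a * (x ^+ 2) ^+ m).
Proof.
by exists `|a| => x x0 x1; rewrite normrM [X in _ * X]ger0_norm// exprn_ge0// sqr_ge0.
Qed.

Lemma bigO_sq_eq n g h : (forall x, 0 < x -> x <= 2^-1 -> g x = h x) -> bigO_sq n g -> bigO_sq n h.
Proof. by move=> E [K HK]; exists K => x x0 x1; rewrite -E ?HK. Qed.

Definition asymptotic f c := forall n,
  bigO_sq n (fun x => f x - \sum_(i < n) c i * (x ^+ 2) ^+ i).

Lemma asymptotic_eq f g c : (forall x, 0 < x -> x <= 2^-1 -> f x = g x) ->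
  asymptotic f c -> asymptotic g c.
Proof. by move=> E H n; apply: bigO_sq_eq (H n) => x x0 x1; rewrite E. Qed.

Lemma sum_triangle n (F : nat -> nat -> R) :
  \sum_(i < n) \sum_(j < n - i) F i j = \sum_(k < n) \sum_(i < k.+1) F i (k - i)%N.
Proof.
elim: n => [|n IH]; first by rewrite !big_ord0.
rewrite [RHS]big_ord_recr /= -IH [X in _ + X]big_ord_recr /= addrA -big_split /=.
rewrite [LHS]big_ord_recr /= subSnn big_ord1 subnn.
congr (_ + _).
by apply: eq_bigr => i _; rewrite subSn 1?ltnW// big_ord_recr.
Qed.

Definition conv c d n := \sum_(i < n.+1) c i * d (n - i)%N.

(** Writing [f_n] for the truncation of [f], the remainder is [(f - f_n) g] plus the sum of
    [c i x^(2 i) (g - g_(n - i))]; the first part uses only that [g] is bounded. *)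
Lemma asymptoticM f g c d : asymptotic f c -> asymptotic g d ->
  asymptotic (fun x => f x * g x) (conv c d).
Proof.
move=> Hf Hg n.
have g0 : bigO_sq 0 g by apply: bigO_sq_eq (Hg 0%N) => x _ _; rewrite big_ord0 subr0.
have h1 := bigO_sqM (Hf n) g0; rewrite addn0 in h1.
have h2 : bigO_sq n (fun x => \sum_(i < n) (c i * (x ^+ 2) ^+ i *
    (g x - \sum_(j < n - i) d j * (x ^+ 2) ^+ j))).
  apply: (@bigO_sq_sum n n (fun i x => c i * (x ^+ 2) ^+ i *
    (g x - \sum_(j < n - i) d j * (x ^+ 2) ^+ j))) => i ilt.
  by rewrite -[X in bigO_sq X](subnKC (ltnW ilt)); apply: bigO_sqM (Hg _); exact: bigO_sq_mono.
apply: bigO_sq_eq (bigO_sqD h1 h2) => x x0 x1.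
rewrite mulrBl mulr_suml -addrA; congr (_ + _).
transitivity (- \sum_(i < n) \sum_(j < n - i) c i * d j * (x ^+ 2) ^+ (i + j)).
  rewrite -!sumrN -big_split /=; apply: eq_bigr => i _.
  rewrite mulrBr addKr mulr_sumr; congr (- _); apply: eq_bigr => j _.
  by rewrite exprD; ring.
rewrite (sum_triangle n (fun i j => c i * d j * (x ^+ 2) ^+ (i + j))); congr (- _).
apply: eq_bigr => k _; rewrite mulr_suml; apply: eq_bigr => i _.
by rewrite subnKC// -ltnS.
Qed.

Lemma asymptotic_uniq f c d : asymptotic f c -> asymptotic f d -> forall n, c n = d n.
Proof.
move=> Hc Hd n; have [k kn] := ubnP n; elim: k n kn => // k IH n nk.
have {}IH m : (m < n)%N -> c m = d m by move=> mn; apply: IH; apply: leq_trans mn _.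
have [K1 H1] := Hc n.+1; have [K2 H2] := Hd n.+1.
apply/eqP; rewrite -subr_eq0 -normr_eq0; apply/negPn/negP => e0.
have {}e0 : 0 < `|c n - d n| by rewrite lt0r e0 normr_ge0.
have K0 : 0 <= K1 + K2.
  have h : 0 < (2^-1 : R) by rewrite invr_gt0.
  have := H1 _ h (lexx _); have := H2 _ h (lexx _).
  have p : 0 < (2^-1 ^+ 2) ^+ n.+1 :> R by rewrite !exprn_gt0.
  move=> /(le_trans (normr_ge0 _)); rewrite pmulr_lge0// => ?.
  by move=> /(le_trans (normr_ge0 _)); rewrite pmulr_lge0// => ?; lra.
have key x : 0 < x -> x <= 2^-1 -> `|c n - d n| <= (K1 + K2) * x ^+ 2.
  move=> x0 x1; have := H1 x x0 x1; have := H2 x x0 x1; rewrite !big_ord_recr /=.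
  have -> : \sum_(i < n) c i * (x ^+ 2) ^+ i = \sum_(i < n) d i * (x ^+ 2) ^+ i.
    by apply: eq_bigr => i _; rewrite IH.
  set S := \sum_(i < n) _; have t0 : 0 < (x ^+ 2) ^+ n by rewrite !exprn_gt0.
  rewrite ![_ ^+ n.+1]exprSr => h2 h1.
  have : `|(c n - d n) * (x ^+ 2) ^+ n| <= (K1 + K2) * ((x ^+ 2) ^+ n * x ^+ 2).
    rewrite (_ : _ * _ = (f x - (S + d n * (x ^+ 2) ^+ n)) - (f x - (S + c n * (x ^+ 2) ^+ n)));
      last by ring.
    by apply: le_trans (ler_normB _ _) _; rewrite mulrDl addrC lerD.
  rewrite normrM (gtr0_norm t0) [X in _ <= _ * X]mulrC mulrA ler_pM2r//.
(* This point is at most [1 / 2] and small enough that [(K1 + K2) y^2] falls below [|c n - d n|]. *)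
have y0 : 0 < `|c n - d n| / (2 * (K1 + K2 + `|c n - d n|)).
  by rewrite divr_gt0// mulr_gt0//; lra.
have y1 : `|c n - d n| / (2 * (K1 + K2 + `|c n - d n|)) <= 2^-1.
  by rewrite ler_pdivrMr; [rewrite mulKf//; lra | lra].
have := key _ y0 y1.
set e := `|_| in e0 y0 y1 *; set y := e / _ in y0 y1 *.
have yE : y * (2 * (K1 + K2 + e)) = e by rewrite /y divfK// gt_eqF//; lra.
have h1 : y ^+ 2 <= y * 2^-1 by rewrite expr2 ler_pM2l.
have h2 : (K1 + K2) * y ^+ 2 <= (K1 + K2) * (y * 2^-1) by rewrite ler_wpM2l.
have h3 : 0 < y * e by rewrite mulr_gt0.
have h4 : 0 <= (K1 + K2) * y by rewrite mulr_ge0// ltW.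
lra.
Qed.

Lemma asymptotic_series f c (M : R) : (forall i, `|c i| <= M) ->
  (forall x, 0 < x -> x <= 2^-1 ->
    (fun N => \sum_(i < N) c i * (x ^+ 2) ^+ i) @ \oo --> f x) -> asymptotic f c.
Proof.
move=> cM H n; exists (2 * M) => x x0 x1.
have M0 : 0 <= M := le_trans (normr_ge0 _) (cM 0%N).
have t0 : 0 <= x ^+ 2 by exact: sqr_ge0.
have t1 : x ^+ 2 <= 2^-1 by nra.
apply: (@sum_tail_le _ (fun m => c m * (x ^+ 2) ^+ m) (fun m => M * (x ^+ 2) ^+ m) _ _ n
  _ (H x x0 x1)).
  move=> m; rewrite normrM (ger0_norm (exprn_ge0 m t0)).
  by apply: ler_wpM2r; [exact: exprn_ge0 | exact: cM].
move=> N nN; rewrite -!mulr_sumr -mulrBr.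
have G k : \sum_(m < k) (x ^+ 2) ^+ m = (1 - (x ^+ 2) ^+ k) / (1 - x ^+ 2).
  by rewrite -[X in _ = X / _]opprB subrX1 -mulNr opprB mulrC mulKf// gt_eqF//; lra.
have e0 : 0 <= (x ^+ 2) ^+ n by rewrite exprn_ge0.
have e1 : 0 <= (x ^+ 2) ^+ N by rewrite exprn_ge0.
rewrite !G -mulrBl (mulrC 2) -mulrA; apply: ler_wpM2l => //.
rewrite ler_pdivrMr; last lra.
nra.
Qed.

(** * Rational multiples of even powers of pi *)

Definition graded n (y : R) := exists q : rat, y = pi ^+ (2 * n) * ratr q.

Lemma gradedD n x y : graded n x -> graded n y -> graded n (x + y).
Proof. by move=> [p ->] [q ->]; exists (p + q); rewrite rmorphD mulrDr. Qed.

Lemma gradedN n x : graded n x -> graded n (- x).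
Proof. by move=> [p ->]; exists (- p); rewrite rmorphN mulrN. Qed.

Lemma gradedM m n x y : graded m x -> graded n y -> graded (m + n) (x * y).
Proof.
by move=> [p ->] [q ->]; exists (p * q); rewrite rmorphM /= mulnDr exprD mulrACA.
Qed.

Lemma graded_sum n k (F : nat -> R) : (forall i, (i < k)%N -> graded n (F i)) ->
  graded n (\sum_(i < k) F i).
Proof.
elim: k => [|k IH] H; first by rewrite big_ord0; exists 0; rewrite rmorph0 mulr0.
rewrite big_ord_recr; apply: gradedD; last exact: H.
by apply: IH => i ik; apply: H; rewrite ltnS ltnW.
Qed.

(** Division by a power series with constant term [1]: the convolution can be solved for [c n] in
    terms of earlier coefficients. *)
Lemma graded_conv c d : d 0%N = 1 -> (forall n, graded n (d n)) ->
  (forall n, graded n (conv c d n)) -> forall n, graded n (c n).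
Proof.
move=> d0 gd gc n; have [k kn] := ubnP n; elim: k n kn => // k IH n nk.
have -> : c n = conv c d n - \sum_(i < n) c i * d (n - i)%N.
  by rewrite /conv big_ord_recr /= subnn d0 mulr1 addrAC subrr add0r.
apply: gradedD => //; apply: gradedN.
apply: (@graded_sum n n (fun i => c i * d (n - i)%N)) => i ilt.
rewrite -[X in graded X](subnKC (ltnW ilt)); apply: gradedM => //.
by apply: IH; apply: leq_trans ilt _.
Qed.

Lemma exp_coeff_bounded (y : R) : exists M, forall n, `|exp_coeff y n| <= M.
Proof.
have /cvg_has_ub[M HM] : cvgn (exp_coeff y) by apply/cvg_ex; exists 0; exact: cvg_exp_coeff.
by exists M => n; apply: HM; exists n.
Qed.

Definition cos_coef n : R := (-1) ^+ n * pi ^+ (2 * n) / (2 * n)`!%:R.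
Definition sin_coef n : R := (-1) ^+ n * pi ^+ (2 * n) / (2 * n).+1`!%:R.

Lemma graded_cos_coef n : graded n (cos_coef n).
Proof.
exists ((-1) ^+ n / (2 * n)`!%:R).
by rewrite fmorph_div rmorphXn /= rmorphN1 ratr_nat /cos_coef; ring.
Qed.

Lemma graded_sin_coef n : graded n (sin_coef n).
Proof.
exists ((-1) ^+ n / (2 * n).+1`!%:R).
by rewrite fmorph_div rmorphXn /= rmorphN1 ratr_nat /sin_coef; ring.
Qed.

Lemma asymptotic_cos : asymptotic (fun x => cos (pi * x)) cos_coef.
Proof.
have [M HM] := exp_coeff_bounded (pi : R).
apply: (@asymptotic_series _ _ M) => [i|x x0 x1].
  apply: le_trans (HM (2 * i)%N); rewrite /cos_coef /exp_coeff /= -mulrA normrM.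
  by rewrite normrX normrN1 expr1n mul1r.
have := @cvg_cos_coeff' R (pi * x).
set f := (X in X @ \oo --> _ -> _); suff -> : f = (fun N => \sum_(i < N) cos_coef i * (x ^+ 2) ^+ i) by [].
rewrite /f seriesEord; apply/funext => N; apply: eq_bigr => i _.
by rewrite /cos_coeff' -exprnP /cos_coef -mul2n exprMn -[(x ^+ 2) ^+ i]exprM; ring.
Qed.

Lemma asymptotic_cos_half : asymptotic (fun x => cos (pi * x / 2)) (fun i => cos_coef i / 4 ^+ i).
Proof.
have [M HM] := exp_coeff_bounded (pi : R).
apply: (@asymptotic_series _ _ M) => [i|x x0 x1].
  apply: le_trans (HM (2 * i)%N); rewrite /cos_coef /exp_coeff /= -!mulrA normrM.
  rewrite normrX normrN1 expr1n mul1r mulrA normrM ler_piMr//.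
  rewrite ger0_norm ?invr_ge0 ?exprn_ge0// invf_le1 ?exprn_gt0//.
  by rewrite exprn_ege1// ler1n.
have := @cvg_cos_coeff' R (pi * x / 2).
set f := (X in X @ \oo --> _ -> _).
suff -> : f = (fun N => \sum_(i < N) cos_coef i / 4 ^+ i * (x ^+ 2) ^+ i) by [].
rewrite /f seriesEord; apply/funext => N; apply: eq_bigr => i _.
have e : 2 ^+ 2 = 4 :> R by ring.
have -> : 4 ^+ i = 2 ^+ (2 * i) :> R by rewrite exprM e.
rewrite /cos_coeff' -exprnP /cos_coef -mul2n expr_div_n exprMn -[(x ^+ 2) ^+ i]exprM; ring.
Qed.

Lemma asymptotic_sin : asymptotic (fun x => sin (pi * x) / (pi * x)) sin_coef.
Proof.
have [M HM] := exp_coeff_bounded (pi : R).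
have p0 := pi_gt0 R.
apply: (@asymptotic_series _ _ (M / pi)) => [i|x x0 x1].
  rewrite ler_pdivlMr// -[X in _ * X](gtr0_norm p0) -normrM.
  apply: le_trans (HM (2 * i).+1); rewrite /sin_coef /exp_coeff /= exprSr.
  rewrite (_ : (-1) ^+ i * pi ^+ (2 * i) / (2 * i).+1`!%:R * pi = (-1) ^+ i * (pi ^+ (2 * i) * pi / (2 * i).+1`!%:R)); last by ring.
  by rewrite normrM normrX normrN1 expr1n mul1r.
have px : pi * x != 0 by rewrite mulf_neq0// gt_eqF.
have : (fun N => series (sin_coeff' (pi * x)) N * (pi * x)^-1) @ \oo --> sin (pi * x) / (pi * x).
  by apply: cvgMl; exact: cvg_sin_coeff'.
set f := (X in X @ \oo --> _ -> _).
suff -> : f = (fun N => \sum_(i < N) sin_coef i * (x ^+ 2) ^+ i) by [].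
rewrite /f seriesEord; apply/funext => N; rewrite mulr_suml; apply: eq_bigr => i _.
rewrite /sin_coeff' -exprnP /sin_coef -mul2n [(pi * x) ^+ _]exprSr.
rewrite (_ : (-1) ^+ i * _ / _ / _ = (-1) ^+ i * (pi * x) ^+ (2 * i) / (2 * i).+1`!%:R * ((pi * x) / (pi * x))); last by ring.
by rewrite divff// mulr1 exprMn -[(x ^+ 2) ^+ i]exprM; ring.
Qed.

Lemma inv_sub_expand k (t m : R) : m != 0 -> m - t != 0 ->
  t / (m - t) = \sum_(i < k) t ^+ i.+1 / m ^+ i.+1 + t ^+ k.+1 / (m ^+ k * (m - t)).
Proof.
move=> m0 mt; elim: k => [|k IH]; first by rewrite big_ord0 add0r expr0 mul1r expr1.
rewrite IH big_ord_recr /= -addrA; congr (_ + _).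
rewrite !exprS; field; rewrite m0 mt expf_neq0//.
Qed.

(** Common source of the zeta and beta values: each term is a geometric series in [x^2 / m^2], and
    the growth of [m] makes the remainders summable. There is no constant term, hence the shift of
    the index. *)
Lemma asymptotic_partial (w m C : nat -> R) f :
  (forall n, n.+1%:R <= m n) -> (forall n, `|w n| <= 1) ->
  (forall i, (fun N => \sum_(n < N) w n / (m n ^+ 2) ^+ i.+1) @ \oo --> C i) ->
  (forall x, 0 < x -> x <= 2^-1 ->
     (fun N => \sum_(n < N) w n * (x ^+ 2 / (m n ^+ 2 - x ^+ 2))) @ \oo --> f x) ->
  asymptotic f (fun i => if i is j.+1 then C j else 0).
Proof.
move=> Hm Hw HC Hf.
have key k x : 0 < x -> x <= 2^-1 ->
    `|f x - \sum_(i < k) C i * (x ^+ 2) ^+ i.+1| <= 4 * (x ^+ 2) ^+ k.+1.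
  move=> x0 x1; have t0 : 0 <= x ^+ 2 by exact: sqr_ge0.
  have t1 : x ^+ 2 <= 2^-1 by nra.
  move: (Hf x x0 x1); move: (x ^+ 2) t0 t1 => t t0 t1 Hft.
  apply: (@cvgr_to_le _ (nbhs \oo) _ _ (fun N => `|\sum_(n < N) w n * (t / (m n ^+ 2 - t)) -
     \sum_(i < k) (\sum_(n < N) w n / (m n ^+ 2) ^+ i.+1) * t ^+ i.+1|)).
    apply: cvg_norm; apply: cvgB => //.
    apply: (@cvg_sum _ 'I_k _ (fun i N => (\sum_(n < N) w n / (m n ^+ 2) ^+ i.+1) * t ^+ i.+1)
      (fun i => C i * t ^+ i.+1)) => i; apply: cvgMl; exact: HC.
  apply: nearW => N.
  have -> : \sum_(i < k) (\sum_(n < N) w n / (m n ^+ 2) ^+ i.+1) * t ^+ i.+1 =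
     \sum_(n < N) w n * \sum_(i < k) t ^+ i.+1 / (m n ^+ 2) ^+ i.+1.
    under eq_bigr do rewrite mulr_suml.
    rewrite exchange_big /=; apply: eq_bigr => n _; rewrite mulr_sumr.
    by apply: eq_bigr => i _; ring.
  rewrite -sumrB; apply: le_trans (ler_norm_sum _ _ _) _.
  apply: (@le_trans _ _ (\sum_(n < N) (2 * t ^+ k.+1 * (n.+1%:R ^+ 2)^-1))); last first.
    rewrite -mulr_sumr.
    apply: le_trans (ler_wpM2l _ (sum_inv_sq_le R N)) _; first by rewrite mulr_ge0 ?exprn_ge0.
    by rewrite le_eqVlt; apply/orP; left; apply/eqP; ring.
  apply: ler_sum => n _; have n1 : 1 <= n.+1%:R :> R by rewrite ler1n.
  have mn := Hm n; have m1 : 1 <= m n by lra.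
  have q1 : n.+1%:R ^+ 2 <= m n ^+ 2 by rewrite ler_sqr ?nnegrE//; lra.
  have q2 : 1 <= n.+1%:R ^+ 2 :> R by nra.
  move: q1 q2; move: (m n ^+ 2) (n.+1%:R ^+ 2 : R) => M q q1 q2.
  rewrite -mulrBr (@inv_sub_expand k t M); [|lra..].
  rewrite addrAC subrr add0r normrM.
  apply: le_trans (_ : 1 * `|t ^+ k.+1 / (M ^+ k * (M - t))| <= _).
    by rewrite ler_wpM2r.
  rewrite mul1r ger0_norm; last first.
    by rewrite divr_ge0 ?exprn_ge0// mulr_ge0 ?exprn_ge0//; lra.
  rewrite [2 * _]mulrC -mulrA ler_wpM2l ?exprn_ge0//.
  rewrite ler_pdivlMr; last lra.
  rewrite mulrC ler_pdivrMr; last by rewrite mulr_gt0 ?exprn_gt0//; lra.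
  have : 1 <= M ^+ k by rewrite exprn_ege1//; lra.
  nra.
case=> [|k].
  exists 4 => x x0 x1; have := key 0%N x x0 x1; rewrite !big_ord0 expr1 expr0; nra.
by exists 4 => x x0 x1; rewrite big_ord_recl /= mul0r add0r; exact: key.
Qed.

(** With these shifts [zeta_lim i] is [zeta (2 i + 2)] and [beta_lim i] is [beta (2 i + 3)]. *)
Definition zeta_lim i : R := limn (fun N => \sum_(n < N) (1 / (n.+1%:R ^+ 2) ^+ i.+1 : R)).
Definition beta_lim i : R :=
  limn (fun N => \sum_(n < N) (sgn R n / odd_nat R n) / (odd_nat R n ^+ 2) ^+ i.+1).

Lemma cvg_zeta i : (fun N => \sum_(n < N) (1 / (n.+1%:R ^+ 2) ^+ i.+1 : R)) @ \oo --> zeta_lim i.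
Proof.
apply: (@cvg_sum_inv_sq _ (fun n => 1 / (n.+1%:R ^+ 2) ^+ i.+1) 1) => n.
rewrite ger0_norm ?divr_ge0 ?exprn_ge0// !mul1r lef_pV2 ?posrE ?exprn_gt0//.
by rewrite -{1}[_ ^+ 2]expr1 ler_weXn2l// -natrX ler1n expn_gt0.
Qed.

Lemma cvg_beta i :
  (fun N => \sum_(n < N) (sgn R n / odd_nat R n) / (odd_nat R n ^+ 2) ^+ i.+1) @ \oo -->
  beta_lim i.
Proof.
apply: (@cvg_sum_inv_sq _ (fun n => (sgn R n / odd_nat R n) / (odd_nat R n ^+ 2) ^+ i.+1) 1) => n.
have n1 := odd_nat_ge1 R n; have n0 := odd_nat_gt0 R n; have nn := odd_nat_ge R n.
rewrite -mulrA -invfM normrM sgn_norm -exprM -exprS.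
rewrite mul1r ger0_norm ?invr_ge0 ?exprn_ge0// mul1r lef_pV2 ?posrE ?exprn_gt0//.
apply: (@le_trans _ _ (odd_nat R n ^+ 2)); first by rewrite ler_sqr ?nnegrE// ltW.
by rewrite ler_weXn2l.
Qed.

(* [zeta (2 i)] and [beta (2 i + 1)] (Dirichlet's beta), with [zeta 0 = - 1 / 2] and
   [beta 1 = pi / 4]. *)
Definition zeta_even i : R := if i is j.+1 then zeta_lim j else - 2^-1.
Definition beta_odd i : R := if i is j.+1 then beta_lim j else pi / 4.

(* The coefficients of [1 / 2 - pi x cot (pi x) / 2] at [0]; multiplying by [sin (pi x) / (pi x)]
   gives a recursion for them. *)
Lemma graded_zeta n : graded n (zeta_even n).
Proof.
have p0 := pi_gt0 R.
pose f x : R := 2^-1 - 2^-1 * (pi * x * cot (pi * x)).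
have nz (x : R) : 0 < x -> x <= 2^-1 -> forall z : int, x != z%:~R.
  move=> x0 x1 z; apply/eqP => xz; move: x0 x1; rewrite xz -[0]/(0%:~R) ltr_int => z0.
  have : 1%:~R <= z%:~R :> R by rewrite ler_int.
  lra.
have Hf : asymptotic f (fun i => if i is j.+1 then zeta_lim j else 0).
  apply: (@asymptotic_partial (fun=> 1) (fun n => n.+1%:R)) => //.
  - by move=> _; rewrite normr1.
  - exact: cvg_zeta.
  - move=> x x0 x1; have h : (fun N => 2^-1 - 2^-1 * (x * cotD N x)) @ \oo --> f x.
      rewrite /f (_ : pi * x * _ = x * (pi * cot (pi * x))); last by ring.
      apply: cvgB; first exact: cvg_cst.
      by apply: cvgMr; apply: cvgMr; exact: cvg_cotD (nz x x0 x1).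
    have E : (fun N => 2^-1 - 2^-1 * (x * cotD N x)) =
      (fun N => \sum_(n < N) 1 * (x ^+ 2 / (n.+1%:R ^+ 2 - x ^+ 2))).
      apply/funext => N; rewrite /cotD mulrDr divff ?gt_eqF// mulrDr mulr1 opprD addrA subrr add0r.
      rewrite !mulr_sumr -sumrN; apply: eq_bigr => i _.
      have h1 : x + i.+1%:R != 0 by rewrite gt_eqF// addr_gt0.
      have h2 : x - i.+1%:R != 0 by rewrite subr_eq0 pmulrn nz.
      have h3 : i.+1%:R ^+ 2 - x ^+ 2 != 0.
        by rewrite subr_sqr mulf_neq0// -?(opprB x) ?oppr_eq0// addrC.
      move: h1 h2 h3; move: (i.+1%:R : R) => q h1 h2 h3.
      by field; rewrite h1 h2 h3.
    by rewrite -E.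
(* [zeta_even 0 = - 1 / 2] supplies the constant term [1], which the expansion of [f] does not
   see. *)
have H1 : asymptotic (fun x => pi * x * cot (pi * x)) (fun i => - 2 * zeta_even i).
  move=> k; have [K HK] := Hf k; exists (2 * K + 1) => x x0 x1; have := HK x x0 x1.
  case: k {HK} => [|k].
    rewrite !big_ord0 !expr0 !subr0 !mulr1 /f => h; set u := pi * x * _ in h *.
    rewrite (_ : u = 1 - 2 * (2^-1 - 2^-1 * u)); last by field.
    apply: le_trans (ler_normB _ _) _; rewrite normr1 normrM ger0_norm//; lra.
  rewrite !big_ord_recl /= mul0r add0r => h.
  have -> : pi * x * cot (pi * x) - (- 2 * - 2^-1 * (x ^+ 2) ^+ 0 +
    \sum_(i < k) - 2 * zeta_lim i * (x ^+ 2) ^+ bump 0 i) =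
    - 2 * (f x - \sum_(i < k) zeta_lim i * (x ^+ 2) ^+ bump 0 i).
    rewrite /f expr0 [in LHS](eq_bigr (fun i : 'I_k => - 2 * (zeta_lim i * (x ^+ 2) ^+ bump 0 i))).
      by rewrite -mulr_sumr; field.
    by move=> i _; rewrite mulrA.
  rewrite normrM normrN normr_nat; apply: le_trans (ler_wpM2l (ler0n R 2) h) _.
  have : 0 <= (x ^+ 2) ^+ k.+1 by rewrite !exprn_ge0// ltW.
  lra.
have H2 := asymptoticM H1 asymptotic_sin.
have H3 : asymptotic (fun x => cos (pi * x)) (conv (fun i => - 2 * zeta_even i) sin_coef).
  apply: asymptotic_eq H2 => x x0 x1.
  have s0 := sin_pi_neq0 (nz x x0 x1).
  have px : pi * x != 0 by rewrite mulf_neq0// gt_eqF.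
  rewrite /cot; move: (pi * x) px s0 => u u0 s0.
  by field; rewrite u0 s0.
have H4 := asymptotic_uniq H3 asymptotic_cos.
have s0 : sin_coef 0 = 1 by rewrite /sin_coef muln0 !expr0 !mul1r invr1.
have [|q Hq] := @graded_conv (fun i => - 2 * zeta_even i) _ s0 graded_sin_coef _ n.
  by move=> m; rewrite H4; exact: graded_cos_coef.
exists (- 2^-1 * q).
by rewrite rmorphM /= rmorphN /= fmorphV /= ratr_nat mulrCA -Hq; field.
Qed.

(** These are the coefficients of [sec (pi x / 2)] at [0], and the product with the cosine is [1].
    The factors [4^i] come from the half argument; [4 / pi] makes the weight even. *)
Lemma graded_beta n : graded n (4 / pi * beta_odd n).
Proof.
have p0 := pi_gt0 R; have pn : pi != 0 :> R by rewrite gt_eqF.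
have pe : 4 / pi * (pi / 4) = 1 :> R.
  by rewrite -(invf_div 4 pi) mulfV// mulf_neq0// invr_neq0.
have no (x : R) : 0 < x -> x <= 2^-1 -> not_odd x.
  move=> x0 x1 l; have l1 := odd_nat_ge1 R l; rewrite gt_eqF//; nra.
have Hf : asymptotic (fun x => pi / 4 * (sec (pi * x / 2) - 1))
    (fun i => if i is j.+1 then beta_lim j else 0).
  apply: (@asymptotic_partial (fun n => sgn R n / odd_nat R n) (odd_nat R)).
  - exact: odd_nat_ge.
  - move=> k; rewrite normrM sgn_norm mul1r normfV ger0_norm ?(ltW (odd_nat_gt0 _ _))//.
    by rewrite invf_le1 ?odd_nat_gt0// odd_nat_ge1.
  - exact: cvg_beta.
  - move=> x x0 x1; have := cvg_sec_term (no x x0 x1).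
    set g := (X in X @ \oo --> _ -> _).
    suff -> : g = (fun N => \sum_(n < N) sgn R n / odd_nat R n * (x ^+ 2 / (odd_nat R n ^+ 2 - x ^+ 2))) by [].
    by apply/funext => N; apply: eq_bigr => i _; rewrite /sec_term invfM; ring.
have H1 : asymptotic (fun x => sec (pi * x / 2)) (fun i => 4 / pi * beta_odd i).
  move=> k; have [K HK] := Hf k; exists (4 / pi * K + 1) => x x0 x1; have := HK x x0 x1.
  have p4 : 0 <= 4 / pi :> R by rewrite divr_ge0// ltW.
  case: k {HK} => [|k].
    rewrite !big_ord0 !expr0 !subr0 !mulr1 => h; set u := sec _ in h *.
    rewrite (_ : u = 1 + 4 / pi * (pi / 4 * (u - 1))); last by rewrite mulrA pe mul1r addrC subrK.
    apply: le_trans (ler_normD _ _) _; rewrite normr1 normrM (ger0_norm p4) addrC.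
    by rewrite lerD2r ler_wpM2l.
  rewrite !big_ord_recl /= mul0r add0r => h.
  have -> : sec (pi * x / 2) - (4 / pi * (pi / 4) * (x ^+ 2) ^+ 0 +
    \sum_(i < k) 4 / pi * beta_lim i * (x ^+ 2) ^+ bump 0 i) =
    4 / pi * (pi / 4 * (sec (pi * x / 2) - 1) - \sum_(i < k) beta_lim i * (x ^+ 2) ^+ bump 0 i).
    rewrite expr0 [in LHS](eq_bigr (fun i : 'I_k => 4 / pi * (beta_lim i * (x ^+ 2) ^+ bump 0 i))).
      by rewrite -mulr_sumr pe mulrBr [4 / pi * (pi / 4 * _)]mulrA pe; ring.
    by move=> i _; rewrite mulrA.
  rewrite normrM (ger0_norm p4); apply: le_trans (ler_wpM2l p4 h) _.
  have : 0 <= (x ^+ 2) ^+ k.+1 by rewrite !exprn_ge0// ltW.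
  lra.
have H2 := asymptoticM H1 asymptotic_cos_half.
have H3 : asymptotic (fun=> 1) (conv (fun i => 4 / pi * beta_odd i) (fun i => cos_coef i / 4 ^+ i)).
  apply: asymptotic_eq H2 => x x0 x1; rewrite /sec mulVf//.
  rewrite gt_eqF// cos_gt0_pihalf//; apply/andP; split; nra.
have H4 : asymptotic (fun=> 1) (fun i => (i == 0%N)%:R).
  move=> k; exists 1 => x x0 x1; rewrite mul1r.
  case: k => [|k]; first by rewrite big_ord0 subr0 normr1 expr0.
  rewrite big_ord_recl /= expr0 mul1r big1 ?addr0 ?subrr ?normr0.
    by rewrite !exprn_ge0// ltW.
  by move=> i _; rewrite mul0r.
have H5 := asymptotic_uniq H3 H4.
have s0 : cos_coef 0 / 4 ^+ 0 = 1 by rewrite /cos_coef muln0 !expr0 !mul1r invr1 mulr1.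
apply: (@graded_conv (fun i => 4 / pi * beta_odd i) (fun i => cos_coef i / 4 ^+ i) s0) => m.
  have [q ->] := graded_cos_coef m; exists (q / 4 ^+ m).
  by rewrite fmorph_div rmorphXn /= ratr_nat; ring.
rewrite H5; case: m => [|m]; [exists 1 | exists 0].
  by rewrite (_ : ratr 1 = 1 :> R) ?muln0 ?mulr1//; exact: rmorph1.
by rewrite (_ : ratr 0 = 0 :> R) ?mulr0//; exact: rmorph0.
Qed.

End Asymptotics.

(** * Summing the double series by rows and by columns *)

Section Reciprocity.
Variable R : realType.
Implicit Types (a : R).

Lemma sum_odd_le (A : nat -> R) (B : R) : (forall m, 0 <= A m) ->
  (forall M, \sum_(m < M) A m <= B) -> forall M, \sum_(l < M) A l.*2.+1 <= B.
Proof.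
move=> A0 AB M; apply: le_trans (AB M.*2).
elim: M => [|M IH]; first by rewrite !big_ord0.
rewrite doubleS !big_ord_recr /=; have := A0 M.*2; lra.
Qed.

Lemma badly_approximable_norm a : badly_approximable a -> badly_approximable `|a|.
Proof.
move=> [c c0 H]; exists c => // p q pq; have [a0|a0] := ger0P a; first exact: H.
by have := H p (- q); rewrite oppr_eq0 rmorphN /= normrN mulrN mulNr => /(_ pq).
Qed.

Lemma badly_approximable_neq0 a : badly_approximable a -> a != 0.
Proof.
move=> [c c0 H]; apply/eqP => a0; have := H 0 1 isT.
by rewrite a0 mul0r subr0 normr0 mul0r leNgt c0.
Qed.

Lemma badly_approximable_int a (p q : int) : badly_approximable a -> q != 0 ->
  p%:~R - a * q%:~R != 0.
Proof.
move=> [c c0 H] q0; apply/eqP => E; have := H p q; rewrite q0 orbT E normr0 mul0r.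
by move=> /(_ isT); rewrite leNgt c0.
Qed.

Lemma badly_approximable_not_odd a n : badly_approximable a -> not_odd (a * n.+1%:R).
Proof.
move=> ba l; rewrite subr_sqr mulf_neq0//.
  exact: (badly_approximable_int l.*2.+1 ba (isT : n.+1%:Z != 0)).
have := @badly_approximable_int a l.*2.+1 (- n.+1%:Z) ba isT.
by rewrite rmorphN /= mulrN opprK.
Qed.

Variables (a : R) (k : nat).
Hypotheses (ba : badly_approximable a) (k0 : (0 < k)%N).

(** Row [n] belongs to the argument [a (n + 1)], column [m] to the odd number [mu = 2 m + 1]. *)
Let F n m := sec_term (a * n.+1%:R) m / n.+1%:R ^+ (2 * k).

(** As [k > 0], each entry is at most [a^2 / (mu |mu^2 - a^2 n^2|)] for the shifted index [n], and
    the lattice estimate applies along odd [mu]. *)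
Lemma reciprocity_dominated : exists (A : nat -> R) (B : R),
  (forall M, \sum_(m < M) A m <= B) /\ forall N m, `|\sum_(n < N) F n m| <= A m.
Proof.
have a0 : 0 < `|a| by rewrite normr_gt0 badly_approximable_neq0.
have [A [B [AB HA]]] := lattice_sum_le a0 (badly_approximable_norm ba).
have A0 m : (0 < m)%N -> 0 <= A m.
  by move=> m0; have := HA m 0%N m0; rewrite big_ord0.
(* The lattice estimate says nothing about [A 0], not even its sign; putting [0] there makes the
   bounding sequence nonnegative. *)
pose A' m := if m is 0%N then 0 else A m.
have AB' M : \sum_(m < M) A' m <= B - A 0%N + `|A 0%N|.
  case: M => [|M].
    rewrite big_ord0; have := AB 1%N; rewrite big_ord1 /=; have := normr_ge0 (A 0%N).
    by lra.
  rewrite big_ord_recl /= add0r; have := AB M.+1; rewrite big_ord_recl /=.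
  have := normr_ge0 (A 0%N); lra.
exists (fun l => a ^+ 2 * A' l.*2.+1), (a ^+ 2 * (B - A 0%N + `|A 0%N|)); split.
  move=> M; rewrite -mulr_sumr ler_wpM2l ?sqr_ge0//.
  by apply: sum_odd_le => //; case=> [|m] //=; exact: A0.
move=> N l; apply: le_trans (ler_norm_sum _ _ _) _.
apply: le_trans (ler_wpM2l (sqr_ge0 a) (HA l.*2.+1 N isT)); rewrite mulr_sumr.
apply: ler_sum => n _; have n1 : 1 <= n.+1%:R :> R by rewrite ler1n.
have n0 : 0 < n.+1%:R ^+ (2 * k) :> R by rewrite exprn_gt0.
have -> : F n l = sgn R l * (a ^+ 2 * (n.+1%:R ^+ 2 / n.+1%:R ^+ (2 * k)) *
    (odd_nat R l * (odd_nat R l ^+ 2 - a ^+ 2 * n.+1%:R ^+ 2))^-1).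
  by rewrite /F /sec_term exprMn; ring.
have h : 0 <= a ^+ 2 * (n.+1%:R ^+ 2 / n.+1%:R ^+ (2 * k)).
  by rewrite mulr_ge0 ?sqr_ge0// divr_ge0 ?exprn_ge0.
rewrite normrM sgn_norm mul1r normrM (ger0_norm h) normfV normrM.
rewrite (gtr0_norm (odd_nat_gt0 R l)) real_normK ?num_real// -/(odd_nat R l).
rewrite ler_wpM2r ?invr_ge0 ?mulr_ge0 ?(ltW (odd_nat_gt0 R l))//.
rewrite ler_piMr ?sqr_ge0// ler_pdivrMr// mul1r ler_weXn2l//.
by rewrite -[X in (X <= _)%N]muln1 leq_mul2l.
Qed.

Lemma reciprocity_row n : (fun M => \sum_(m < M) F n m) @ \oo -->
  pi / 4 * (sec (pi * n.+1%:R * (a / 2)) - 1) / n.+1%:R ^+ (2 * k).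
Proof.
have := cvg_sec_term (badly_approximable_not_odd n ba).
have -> : pi * (a * n.+1%:R) / 2 = pi * n.+1%:R * (a / 2) by ring.
move=> h; have -> : (fun M => \sum_(m < M) F n m) =
   (fun M => (\sum_(m < M) sec_term (a * n.+1%:R) m) / n.+1%:R ^+ (2 * k)).
  by apply/funext => M; rewrite mulr_suml.
exact: cvgMl.
Qed.

(** Partial fractions in [t = a^2 n^2] with [m = mu^2]: the pure powers of [1 / t] will sum to zeta
    values, the last term to a cotangent. *)
Lemma inv_sub_expand_rev j (t m : R) : m != 0 -> t != 0 -> m - t != 0 ->
  t / (t ^+ j.+1 * (m - t)) =
  \sum_(i < j) (t ^+ (j - i) * m ^+ i.+1)^-1 + (m ^+ j * (m - t))^-1.
Proof.
move=> m0 t0 mt; elim: j => [|j IH].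
  by rewrite big_ord0 add0r !expr0 expr1 mul1r invfM mulVKf.
rewrite big_ord_recl /= subn0 expr1.
have -> : \sum_(i < j) (t ^+ (j.+1 - bump 0 i) * m ^+ (bump 0 i).+1)^-1 =
   m^-1 * \sum_(i < j) (t ^+ (j - i) * m ^+ i.+1)^-1.
  rewrite mulr_sumr; apply: eq_bigr => i _.
  by rewrite /bump /= add1n subSS -invfM [m * _]mulrCA -exprS.
have -> : (m ^+ j.+1 * (m - t))^-1 = m^-1 * (m ^+ j * (m - t))^-1.
  by rewrite exprS -mulrA invfM.
rewrite -addrA -mulrDr -IH ![t ^+ _.+1]exprS.
by field; rewrite m0 t0 mt expf_neq0.
Qed.

Definition cot_term m : R := sgn R m * (pi * cot (pi * (odd_nat R m / a))) / odd_nat R m ^+ (2 * k).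

Lemma reciprocity_col m : (fun N => \sum_(n < N) F n m) @ \oo -->
  \sum_(j < k) (a ^+ (2 * j.+1) * zeta_even R (k - j.+1) *
     ((sgn R m / odd_nat R m) / (odd_nat R m ^+ 2) ^+ j.+1)) +
  a ^+ (2 * k).-1 / 2 * cot_term m.
Proof.
have a0 := badly_approximable_neq0 ba.
have m0 : odd_nat R m != 0 by rewrite gt_eqF// odd_nat_gt0.
have xz (z : int) : odd_nat R m / a != z%:~R.
  apply/eqP => E; have : odd_nat R m = a * z%:~R by rewrite -E mulrCA divff// mulr1.
  have [->|z0] := eqVneq z 0; first by rewrite mulr0; exact/eqP.
  move/eqP; rewrite -subr_eq0; apply/negP.
  exact: (@badly_approximable_int a m.*2.+1 z ba z0).
have hq := badly_approximable_not_odd.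
have [k' kE] : exists k', k = k'.+1 by exists k.-1; rewrite prednK.
set M := odd_nat R m ^+ 2; set w := sgn R m / odd_nat R m.
have M0 : M != 0 by rewrite expf_neq0.
have FE n : F n m = \sum_(i < k') (a ^+ (2 * i.+1) * (w / M ^+ i.+1) *
      (1 / (n.+1%:R ^+ 2) ^+ (k' - i))) +
    w * a ^+ (2 * k) / M ^+ k' * (M - a ^+ 2 * n.+1%:R ^+ 2)^-1.
  have n0 : n.+1%:R != 0 :> R by [].
  have t0 : a ^+ 2 * n.+1%:R ^+ 2 != 0 by rewrite mulf_neq0 ?expf_neq0.
  have Mt : M - a ^+ 2 * n.+1%:R ^+ 2 != 0 by rewrite -exprMn; exact: hq.
  have -> : F n m = w * a ^+ (2 * k) * (a ^+ 2 * n.+1%:R ^+ 2 /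
      ((a ^+ 2 * n.+1%:R ^+ 2) ^+ k * (M - a ^+ 2 * n.+1%:R ^+ 2))).
    rewrite /F /sec_term -/M [(a * n.+1%:R) ^+ 2]exprMn [(a ^+ 2 * _) ^+ k]exprMn.
    rewrite -(exprM a) -(exprM n.+1%:R) /w.
    have := expf_neq0 (2 * k) a0; have := expf_neq0 (2 * k) n0.
    move: (a ^+ (2 * k)) (n.+1%:R ^+ (2 * k) : R) => u v v0 u0.
    move: Mt m0 {t0}; move: (a ^+ 2 * n.+1%:R ^+ 2) (odd_nat R m) => t mu Mt m0.
    by field; rewrite m0 Mt u0 v0.
  rewrite kE inv_sub_expand_rev// mulrDr mulr_sumr; congr (_ + _); last first.
    by rewrite invfM; ring.
  apply: eq_bigr => i _; rewrite exprMn.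
  have -> : a ^+ (2 * k'.+1) = a ^+ (2 * i.+1) * a ^+ (2 * (k' - i)).
    by rewrite -exprD; congr (_ ^+ _); have := ltn_ord i; lia.
  rewrite -(exprM a); have := expf_neq0 (2 * (k' - i)) a0.
  have := expf_neq0 i.+1 M0; have := expf_neq0 (k' - i) (expf_neq0 2 n0).
  move: (a ^+ (2 * (k' - i))) (M ^+ i.+1) ((n.+1%:R ^+ 2) ^+ (k' - i) : R).
  move=> u v y y0 v0 u0; move: (a ^+ (2 * i.+1)) w => ? ?.
  by field; rewrite y0 v0 u0.
(* This is the cotangent expansion at [mu / a] without its polar term [a / mu]. *)
have QE N : \sum_(n < N) (M - a ^+ 2 * n.+1%:R ^+ 2)^-1 =
    (cotD N (odd_nat R m / a) - (odd_nat R m / a)^-1) / (2 * odd_nat R m * a).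
  rewrite /cotD addrAC subrr add0r mulr_suml; apply: eq_bigr => n _.
  have h1 : odd_nat R m - a * n.+1%:R != 0.
    exact: (@badly_approximable_int a m.*2.+1 n.+1 ba isT).
  have h2 : odd_nat R m + a * n.+1%:R != 0.
    have := @badly_approximable_int a m.*2.+1 (- n.+1%:Z) ba isT.
    by rewrite rmorphN /= mulrN opprK.
  rewrite /M; move: (odd_nat R m) (n.+1%:R : R) m0 h1 h2 {FE w M0 xz} => mu q m0 h1 h2.
  have -> : mu / a + q = (mu + a * q) / a by field.
  have -> : mu / a - q = (mu - a * q) / a by field.
  rewrite !invf_div -exprMn subr_sqr.
  by field; rewrite a0 m0 h1 h2.
have -> : (fun N => \sum_(n < N) F n m) = (fun N =>
    \sum_(i < k') (a ^+ (2 * i.+1) * (w / M ^+ i.+1) *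
      \sum_(n < N) (1 / (n.+1%:R ^+ 2) ^+ (k' - i))) +
    w * a ^+ (2 * k) / M ^+ k' *
    ((cotD N (odd_nat R m / a) - (odd_nat R m / a)^-1) / (2 * odd_nat R m * a))).
  apply/funext => N; under eq_bigr do rewrite FE.
  rewrite big_split /= -mulr_sumr QE; congr (_ + _).
  by rewrite exchange_big /=; apply: eq_bigr => i _; rewrite mulr_sumr.
(* The missing polar term becomes the summand [j = k - 1], because [zeta_even 0 = - 1 / 2]. *)
have -> : \sum_(j < k) a ^+ (2 * j.+1) * zeta_even R (k - j.+1) * (w / M ^+ j.+1) +
   a ^+ (2 * k).-1 / 2 * cot_term m =
   \sum_(i < k') (a ^+ (2 * i.+1) * (w / M ^+ i.+1) * zeta_even R (k' - i)) +
   w * a ^+ (2 * k) / M ^+ k' *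
    ((pi * cot (pi * (odd_nat R m / a)) - (odd_nat R m / a)^-1) / (2 * odd_nat R m * a)).
  have -> : (2 * k).-1 = (2 * k').+1 by rewrite kE; lia.
  rewrite /cot_term kE big_ord_recr /= -addrA; congr (_ + _).
    by apply: eq_bigr => i _; rewrite subSS; ring.
  rewrite subnn /= /w.
  have -> : odd_nat R m ^+ (2 * k'.+1) = M ^+ k' * M.
    by rewrite -exprSr -exprM.
  have -> : a ^+ (2 * k'.+1) = a ^+ (2 * k').+1 * a by rewrite -exprSr mulnS.
  rewrite [M ^+ k'.+1]exprSr invf_div; have := expf_neq0 k' M0; rewrite /M.
  move: (a ^+ (2 * k').+1) ((odd_nat R m ^+ 2) ^+ k') (cot _) => u v c v0.
  move: (odd_nat R m) (sgn R m) m0 => mu s m0.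
  by field; rewrite a0 m0 v0.
apply: cvgD.
  apply: (@cvg_sum _ 'I_k' _ (fun i N => a ^+ (2 * i.+1) * (w / M ^+ i.+1) *
     \sum_(n < N) (1 / (n.+1%:R ^+ 2) ^+ (k' - i))) (fun i => a ^+ (2 * i.+1) * (w / M ^+ i.+1) *
     zeta_even R (k' - i))) => i.
  apply: cvgMr; have -> : (k' - i = (k' - i.+1).+1)%N by have := ltn_ord i; lia.
  exact: cvg_zeta.
apply: cvgMr; apply: cvgMl; apply: cvgB; last exact: cvg_cst.
exact: cvg_cotD.
Qed.

(* The term [j = 0] comes from the [1] in the expansion of the secant; with [zeta_even 0 = - 1 / 2]
   the term [j = k] fits the pattern. *)
Lemma secant_sum_value : exists2 Phi : R, (fun M => \sum_(m < M) cot_term m) @ \oo --> Phi &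
  (fun N => \sum_(n < N) sec (pi * n.+1%:R * (a / 2)) / n.+1%:R ^+ (2 * k)) @ \oo -->
   4 / pi * \sum_(j < k.+1) (a ^+ (2 * j) * zeta_even R (k - j) * beta_odd R j) +
   2 / pi * a ^+ (2 * k).-1 * Phi.
Proof.
have p0 : pi != 0 :> R by rewrite gt_eqF// pi_gt0.
have a0 := badly_approximable_neq0 ba.
have [A [B [AB HA]]] := reciprocity_dominated.
have row N : (fun M => \sum_(m < M) \sum_(n < N) F n m) @ \oo -->
    \sum_(n < N) pi / 4 * (sec (pi * n.+1%:R * (a / 2)) - 1) / n.+1%:R ^+ (2 * k).
  under [X in X @ \oo --> _]eq_fun do rewrite exchange_big /=.
  apply: (@cvg_sum _ 'I_N _ (fun n M => \sum_(m < M) F n m) (fun n =>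
    pi / 4 * (sec (pi * n.+1%:R * (a / 2)) - 1) / n.+1%:R ^+ (2 * k))) => n.
  exact: reciprocity_row.
have [l hl gl] := tannery HA AB reciprocity_col row.
set K : R := a ^+ (2 * k).-1 / 2 in hl.
have K0 : K != 0 by rewrite mulf_neq0 ?expf_neq0.
pose C j := a ^+ (2 * j.+1) * zeta_even R (k - j.+1).
pose S := \sum_(j < k) C j * beta_lim R j.
have hS : (fun M => \sum_(j < k) C j * \sum_(m < M) (sgn R m / odd_nat R m) / (odd_nat R m ^+ 2) ^+ j.+1)
    @ \oo --> S.
  apply: (@cvg_sum _ 'I_k _ (fun j M => C j * \sum_(m < M) (sgn R m / odd_nat R m) / (odd_nat R m ^+ 2) ^+ j.+1)
    (fun j => C j * beta_lim R j)) => j.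
  by apply: cvgMr; exact: cvg_beta.
(* Only the sum of the full columns is known to converge; the cotangent series then converges
   because the beta series can be subtracted and [K] is nonzero. *)
exists ((l - S) / K).
  have -> : (fun M => \sum_(m < M) cot_term m) = (fun M =>
     (\sum_(m < M) (\sum_(j < k) (a ^+ (2 * j.+1) * zeta_even R (k - j.+1) *
     ((sgn R m / odd_nat R m) / (odd_nat R m ^+ 2) ^+ j.+1)) + K * cot_term m) -
     \sum_(j < k) C j * \sum_(m < M) (sgn R m / odd_nat R m) / (odd_nat R m ^+ 2) ^+ j.+1) / K).
    apply/funext => M; rewrite big_split /= exchange_big /= -mulr_sumr.
    rewrite (eq_bigr (fun j : 'I_k => C j * \sum_(m < M) (sgn R m / odd_nat R m) / (odd_nat R m ^+ 2) ^+ j.+1)).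
      by rewrite addrAC subrr add0r mulrC mulKf.
    by move=> j _; rewrite mulr_sumr.
  by apply: cvgMl; apply: cvgB.
have -> : (fun N => \sum_(n < N) sec (pi * n.+1%:R * (a / 2)) / n.+1%:R ^+ (2 * k)) = (fun N =>
   4 / pi * \sum_(n < N) pi / 4 * (sec (pi * n.+1%:R * (a / 2)) - 1) / n.+1%:R ^+ (2 * k) +
   \sum_(n < N) (1 / (n.+1%:R ^+ 2) ^+ k.-1.+1)).
  apply/funext => N; rewrite mulr_sumr -big_split; apply: eq_bigr => n _.
  rewrite prednK// -exprM /=.
  have : n.+1%:R ^+ (2 * k) != 0 :> R by rewrite expf_neq0.
  move: (n.+1%:R ^+ (2 * k) : R) (sec _) => u v u0.
  by move: (pi : R) p0 => p p0; field; rewrite u0 p0.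
have -> : 4 / pi * \sum_(j < k.+1) (a ^+ (2 * j) * zeta_even R (k - j) * beta_odd R j) +
   2 / pi * a ^+ (2 * k).-1 * ((l - S) / K) = 4 / pi * l + zeta_lim R k.-1.
  rewrite big_ord_recl /= subn0 muln0 expr0 mul1r.
  have -> : zeta_even R k = zeta_lim R k.-1 by case: (k) k0.
  have -> : \sum_(i < k) a ^+ (2 * bump 0 i) * zeta_even R (k - bump 0 i) * beta_lim R i = S.
    by apply: eq_bigr => j _; rewrite /bump add1n.
  have -> : 2 / pi * a ^+ (2 * k).-1 = 4 / pi * K.
    rewrite /K; move: (a ^+ _) (pi : R) p0 => u p p0'.
    by field; rewrite ?p0'.
  move: K0 p0; move: (zeta_lim R k.-1) (K) (S) (pi : R) => z K' S' p K1 p1.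
  by field; rewrite K1 p1.
by apply: cvgD; [apply: cvgMr | exact: cvg_zeta].
Qed.

End Reciprocity.

(** * Quadratic irrationals and Pell's equation *)

Section QuadraticIrrationals.
Variable R : realType.
Implicit Types x y s : R.

Definition irrational x := forall p q : int, q != 0 -> q%:~R * x != p%:~R.

Definition quadratic_irr x := irrational x /\ exists A B C : int,
  A != 0 /\ A%:~R * x ^+ 2 + B%:~R * x + C%:~R = 0.

Lemma quadratic_form_factor x (A B C m n : int) :
  A%:~R * x ^+ 2 + B%:~R * x + C%:~R = 0 ->
  (A * m ^+ 2 + B * m * n + C * n ^+ 2)%:~R =
  (m%:~R - x * n%:~R) * (A%:~R * m%:~R + (B%:~R + A%:~R * x) * n%:~R) :> R.
Proof.
move=> /eqP; rewrite addr_eq0 => /eqP E.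
rewrite !rmorphD !rmorphM /= -[C%:~R]opprK -E; ring.
Qed.

Lemma quadratic_form_neq0 x (A B C m n : int) : irrational x -> A != 0 ->
  A%:~R * x ^+ 2 + B%:~R * x + C%:~R = 0 -> (m != 0) || (n != 0) ->
  A * m ^+ 2 + B * m * n + C * n ^+ 2 != 0.
Proof.
move=> ix A0 E mn; rewrite -(intr_eq0 R) (quadratic_form_factor m n E).
have [n0|n0] := eqVneq n 0.
  rewrite n0 eqxx orbF in mn *; rewrite !mulr0 subr0 addr0.
  by rewrite !mulf_neq0 ?intr_eq0.
rewrite mulf_neq0//.
  by rewrite subr_eq0 eq_sym mulrC ix.
have := ix (- (A * m + B * n)) (A * n); rewrite mulf_neq0// => /(_ isT).
apply: contra => /eqP h; apply/eqP.
by rewrite rmorphN rmorphD !rmorphM /= -[LHS]subr0 -h; ring.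
Qed.

(** Liouville's argument: at [(p, 2 q)] the form takes a nonzero integer value, of which [p - 2 x q]
    is one factor; the other is at most [2 K (|p| + |q|)]. *)
Lemma quadratic_irr_bad x : quadratic_irr x -> badly_approximable (2 * x).
Proof.
move=> [ix [A [B [C [A0 E]]]]].
pose K : R := `|A%:~R| + `|B%:~R| + `|A%:~R| * `|x| + 1.
have K0 : 0 < K by rewrite ltr_pwDr// !addr_ge0// mulr_ge0.
exists (2 * K)^-1; first by rewrite invr_gt0 mulr_gt0.
move=> p q pq; rewrite -div1r ler_pdivrMr ?mulr_gt0//.
have := @quadratic_form_neq0 x A B C p (2 * q) ix A0 E.
rewrite mulf_eq0 /= pq => /(_ isT) N0.
have : 1 <= `|(A * p ^+ 2 + B * p * (2 * q) + C * (2 * q) ^+ 2)%:~R| :> R.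
  by rewrite -intr_norm -[1]/(1%:~R) ler_int; move: N0; lia.
rewrite (quadratic_form_factor p (2 * q) E) normrM rmorphM /= => h1.
have -> : p%:~R - 2 * x * q%:~R = p%:~R - x * (2 * q%:~R) by ring.
apply: le_trans h1 _; rewrite -mulrA; apply: ler_wpM2l => //.
apply: le_trans (ler_normD _ _) _; rewrite !normrM.
have := normr_ge0 (p%:~R : R); have := normr_ge0 (q%:~R : R).
have := ler_normD (B%:~R) (A%:~R * x); rewrite normrM normr_nat /K.
have := normr_ge0 (A%:~R : R); have := normr_ge0 (B%:~R : R); have := normr_ge0 x.
move: (normr_ge0 (B%:~R + A%:~R * x)).
move: `|A%:~R| `|B%:~R| `|x| `|p%:~R| `|q%:~R| `|_ + _| => a b c u v w.
move=> w0 c0 b0 a0 hw v0 u0.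
have ac : 0 <= a * c by rewrite mulr_ge0.
have h2 : w * (2 * v) <= (b + a * c) * (2 * v) by rewrite ler_wpM2r// mulr_ge0.
have h3 : 0 <= (b + a * c + 1) * u by rewrite mulr_ge0//; lra.
have h4 : 0 <= (a + 1) * v by rewrite mulr_ge0//; lra.
have h5 : 0 <= a * u by rewrite mulr_ge0.
lra.
Qed.

Lemma irrational_den x (c d : int) : irrational x -> (c != 0) || (d != 0) ->
  c%:~R * x + d%:~R != 0.
Proof.
move=> ix cd; have [c0|c0] := eqVneq c 0.
  by rewrite c0 eqxx in cd *; rewrite mul0r add0r intr_eq0.
by rewrite addr_eq0 -rmorphN /= ix.
Qed.

Lemma quadratic_irr_moebius x (a b c d : int) : a * d - b * c = 1 ->
  quadratic_irr x -> quadratic_irr ((a%:~R * x + b%:~R) / (c%:~R * x + d%:~R)).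
Proof.
move=> det [ix [A [B [C [A0 E]]]]].
have cd : (c != 0) || (d != 0).
  by apply/negPn/negP; rewrite negb_or !negbK => /andP[/eqP c0 /eqP d0]; move: det; lia.
have D0 := irrational_den ix cd.
split=> [p q q0|].
  apply/eqP => h.
  have : (q * a - p * c)%:~R * x + (q * b - p * d)%:~R == 0.
    rewrite !rmorphB !rmorphM /= -[p%:~R]divr1 -h; apply/eqP.
    by rewrite divr1; field.
  apply/negP; apply: irrational_den => //.
  apply/negPn/negP; rewrite negb_or !negbK => /andP[/eqP h1 /eqP h2].
  have : q * (a * d - b * c) = 0.
    rewrite (_ : _ * _ = (q * a - p * c) * d - (q * b - p * d) * c); last by ring.
    by rewrite h1 h2; ring.
  by rewrite det mulr1 => q1; rewrite q1 in q0.
(* Coefficients of the form composed with the inverse matrix; the leading one is a value of the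
   original form, hence nonzero. *)
exists (A * (- d) ^+ 2 + B * (- d) * c + C * c ^+ 2).
exists (- A * d * b *+ 2 + B * (a * d + b * c) - C * a * c *+ 2).
exists (A * b ^+ 2 - B * a * b + C * a ^+ 2); split.
  by apply: quadratic_form_neq0 ix A0 E _; rewrite oppr_eq0 orbC.
pose y : R := (a%:~R * x + b%:~R) / (c%:~R * x + d%:~R); rewrite -/y.
have detR : a%:~R * d%:~R - b%:~R * c%:~R = 1 :> R by rewrite -!rmorphM -rmorphB det.
apply: (mulIf (expf_neq0 2 D0)); rewrite mul0r.
have yE : y * (c%:~R * x + d%:~R) = a%:~R * x + b%:~R by rewrite /y divfK.
transitivity ((A%:~R * x ^+ 2 + B%:~R * x + C%:~R) * (a%:~R * d%:~R - b%:~R * c%:~R) ^+ 2 : R);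
  last by rewrite E mul0r.
rewrite !(rmorphD, rmorphB, rmorphM, rmorphN, rmorphMn, rmorphXn) /= !expr2.
rewrite [_ * ((c%:~R * x + d%:~R) * (c%:~R * x + d%:~R))](_ : _ =
  (A%:~R * d%:~R ^+ 2 - B%:~R * d%:~R * c%:~R + C%:~R * c%:~R ^+ 2) * (y * (c%:~R * x + d%:~R)) ^+ 2
  + (- A%:~R * d%:~R * b%:~R *+ 2 + B%:~R * (a%:~R * d%:~R + b%:~R * c%:~R) - C%:~R * a%:~R * c%:~R *+ 2)
   * (y * (c%:~R * x + d%:~R)) * (c%:~R * x + d%:~R) +
  (A%:~R * b%:~R ^+ 2 - B%:~R * a%:~R * b%:~R + C%:~R * a%:~R ^+ 2) * (c%:~R * x + d%:~R) ^+ 2);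
  last by ring.
by rewrite yE; ring.
Qed.

(** * Pell's equation from Dirichlet's approximation theorem *)

Lemma dirichlet_approximation s (N : nat) : (0 < N)%N ->
  exists (p : int) (q : nat), [/\ (0 < q)%N, (q <= N)%N & `|p%:~R - q%:R * s| < N%:R^-1].
Proof.
move=> N0; have NR : 0 < N%:R :> R by rewrite ltr0n.
pose fr (i : nat) := i%:R * s - (Num.floor (i%:R * s))%:~R.
have fr01 i : 0 <= fr i < 1.
  have /andP[h1 h2] := floor_itv (i%:R * s); rewrite subr_ge0 h1 /= ltrBlDl.
  by rewrite intrD in h2.
have Nfr i : 0 <= N%:R * fr i by have /andP[? _] := fr01 i; rewrite mulr_ge0.
have lt i : (Num.truncn (N%:R * fr i) < N)%N.
  have /andP[_ h] := fr01 i.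
  by rewrite truncn_lt_nat// -[ltRHS]mulr1 ltr_pM2l.
pose f (i : 'I_N.+1) : 'I_N := Ordinal (lt i).
have /injectivePn[i [j ij fij]] : ~~ injectiveb f.
  by apply/negP => /injectiveP /leq_card; rewrite !card_ord ltnn.
wlog ltij : i j ij fij / (i < j)%N.
  move=> H; have [/H|ji|/val_inj e] := ltngtP (i : nat) j; first exact.
    by apply: (H j i) => //; rewrite eq_sym.
  by rewrite e eqxx in ij.
exists (Num.floor (j%:R * s) - Num.floor (i%:R * s)), (j - i)%N; split.
- by rewrite subn_gt0.
- by rewrite (leq_trans (leq_subr _ _))// -ltnS.
have -> : (Num.floor (j%:R * s) - Num.floor (i%:R * s))%:~R - (j - i)%:R * s = fr i - fr j.
  by rewrite /fr natrB ?(ltnW ltij)// rmorphB /=; ring.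
have := truncn_itv (Nfr i); have := truncn_itv (Nfr j).
have := congr1 val fij => /= ->; set t := Num.truncn _ => /andP[h1 h2] /andP[h3 h4].
rewrite -natr1 in h2 h4.
rewrite -[ltRHS]div1r ltr_pdivlMr// -[X in _ * X](gtr0_norm NR) -normrM ltr_norml.
by apply/andP; split; lra.
Qed.

Lemma pell_norm_factor (D p : int) (q : nat) s : s ^+ 2 = D%:~R ->
  (p ^+ 2 - D * q%:Z ^+ 2)%:~R = (p%:~R - q%:R * s) * (p%:~R + q%:R * s) :> R.
Proof.
move=> sD; transitivity (p%:~R ^+ 2 - s ^+ 2 * q%:R ^+ 2 : R); last by ring.
by rewrite sD [q%:R]pmulrn -!rmorphXn -rmorphM -rmorphB.
Qed.

(** The bound [m] is uniform in [e]: one factor of the norm is at most [1 / q], the other at most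
    [1 + 2 q |s|]. *)
Lemma pell_approximations (D : int) s : s ^+ 2 = D%:~R -> irrational s ->
  exists m : nat, forall e : R, 0 < e -> exists (p : int) (q : nat),
    [/\ (0 < q)%N, `|p%:~R - q%:R * s| < e & (`|(p ^+ 2 - D * q%:Z ^+ 2)%R| <= m)%N].
Proof.
move=> sD si; exists (Num.truncn (1 + 2 * `|s|)) => e e0.
have ei : 0 <= e^-1 by rewrite invr_ge0 ltW.
have [p [q [q0 qN h]]] := @dirichlet_approximation s (Num.truncn e^-1).+1 isT.
set N : nat := (Num.truncn e^-1).+1 in qN h.
have NR : 0 < N%:R :> R by [].
exists p, q; split=> //.
  apply: lt_trans h _; have /andP[_ h'] := truncn_itv ei.
  by rewrite -[ltRHS]invrK ltf_pV2 ?posrE ?invr_gt0.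
rewrite truncn_ge_nat; last by rewrite addr_ge0// mulr_ge0.
rewrite natr_absz intr_norm (pell_norm_factor _ _ sD) normrM.
have q1 : 1 <= q%:R :> R by rewrite ler1n.
have qNR : q%:R <= N%:R :> R by rewrite ler_nat.
have h1 : `|p%:~R - q%:R * s| * q%:R <= 1.
  apply: le_trans (_ : N%:R^-1 * N%:R <= _); last by rewrite mulVf ?gt_eqF.
  by apply: ler_pM => //; exact: ltW.
have h2 : `|p%:~R + q%:R * s| <= `|p%:~R - q%:R * s| + 2 * (q%:R * `|s|).
  have -> : p%:~R + q%:R * s = (p%:~R - q%:R * s) + 2 * (q%:R * s) by ring.
  by apply: le_trans (ler_normD _ _) _; rewrite !normrM !normr_nat.
set u := `|p%:~R - _| in h1 h2 *.
have u0 : 0 <= u by exact: normr_ge0.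
have u1 : u <= 1 by nra.
apply: le_trans (ler_wpM2l u0 h2) _.
have : (u * q%:R) * `|s| <= 1 * `|s| by rewrite ler_wpM2r.
nra.
Qed.

Lemma absz_shift_inj (m : nat) (x y : int) : (`|x| <= m)%N -> (`|y| <= m)%N ->
  `|(x + m%:Z)%R|%N = `|(y + m%:Z)%R|%N -> x = y.
Proof. by clear; lia. Qed.

Lemma absz_shift_lt (m : nat) (x : int) : (`|x| <= m)%N -> (`|(x + m%:Z)%R| < (2 * m).+1)%N.
Proof. by clear; lia. Qed.

Lemma absz_inj_ge0 (x y : int) : 0 <= x -> 0 <= y -> `|x|%N = `|y|%N -> x = y.
Proof. by clear; lia. Qed.

Lemma absz_modz_lt (m : nat) (x t : int) : t != 0 -> (`|t| <= m)%N -> (`|(x %% t)%Z| < m.+1)%N.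
Proof.
move=> t0; have := modz_ge0 x t0; have := ltz_mod x t0; move: (x %% t)%Z => y.
by clear; lia.
Qed.

(* [(x1 + y1 sqrt D) (x2 - y2 sqrt D) / T] is an integral element of norm 1. *)
Lemma pell_compose (D x1 y1 x2 y2 T : int) : T != 0 ->
  x1 ^+ 2 - D * y1 ^+ 2 = T -> x2 ^+ 2 - D * y2 ^+ 2 = T -> 0 < y1 -> 0 < y2 ->
  (x1 = x2 %[mod T])%Z -> (y1 = y2 %[mod T])%Z -> (x1, y1) != (x2, y2) ->
  exists x y : int, y != 0 /\ x ^+ 2 - D * y ^+ 2 = 1.
Proof.
move=> T0 E1 E2 y1p y2p /eqP; rewrite eqz_mod_dvd => /dvdzP[a ea] /eqP.
rewrite eqz_mod_dvd => /dvdzP[b eb] ne.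
have ex : x1 = x2 + a * T by rewrite -ea; ring.
have ey : y1 = y2 + b * T by rewrite -eb; ring.
pose X := 1 + a * x2 - D * b * y2; pose Y := a * y2 - b * x2.
have XT : X * T = x1 * x2 - D * y1 * y2.
  by rewrite /X ex ey mulrBl mulrDl mul1r -{1}E2; ring.
have YT : Y * T = x1 * y2 - x2 * y1 by rewrite /Y ex ey; ring.
exists X, Y; split.
  apply/eqP => Y0; move: YT; rewrite Y0 mul0r => /esym/eqP; rewrite subr_eq0 => /eqP h.
  have : T * (y2 ^+ 2 - y1 ^+ 2) = 0.
    rewrite mulrBr -{1}E1 -{1}E2.
    transitivity ((x1 * y2) ^+ 2 - (x2 * y1) ^+ 2); first by ring.
    by rewrite h subrr.
  move/eqP; rewrite mulf_eq0 (negPf T0) /= subr_eq0 eqrXn2 ?ltW// => /eqP y12.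
  move: h; rewrite y12 => /mulIf; rewrite y12 in ne.
  move=> /(_ ltac:(by rewrite gt_eqF)) h; move: ne; by rewrite h eqxx.
apply: (mulIf (expf_neq0 2 T0)).
transitivity ((X * T) ^+ 2 - D * (Y * T) ^+ 2); first by ring.
rewrite XT YT mul1r; transitivity ((x1 ^+ 2 - D * y1 ^+ 2) * (x2 ^+ 2 - D * y2 ^+ 2)); first by ring.
by rewrite E1 E2 expr2.
Qed.

Lemma pell (D : int) s : s ^+ 2 = D%:~R -> irrational s ->
  exists x y : int, y != 0 /\ x ^+ 2 - D * y ^+ 2 = 1.
Proof.
move=> sD si; have [m Hm] := pell_approximations sD si.
have Hm' e : exists u : int * nat, 0 < e -> [/\ (0 < u.2)%N, `|u.1%:~R - u.2%:R * s| < e &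
    (`|(u.1 ^+ 2 - D * u.2%:Z ^+ 2)%R| <= m)%N].
  (* A dummy pair for [e <= 0] makes the choice function total. *)
  have [e0|e0] := ltP 0 e; last by exists (0, 0%N) => h; lra.
  by have [p [q h]] := Hm e e0; exists (p, q).
have [g Hg] := choice Hm'.
pose dist (u : int * nat) := `|u.1%:~R - u.2%:R * s|.
have dist_gt0 u : (0 < u.2)%N -> 0 < dist u.
  move=> u2; rewrite normr_gt0 subr_eq0 eq_sym.
  exact: (si u.1 u.2%:Z (lt0n_neq0 u2)).
(* Each approximation is asked to beat the distance of the previous one, so the pairs are
   distinct. *)
pose u := fix u n := if n is n'.+1 then g (dist (u n')) else g 1.
have Hu n : (0 < (u n).2)%N /\ (`|((u n).1 ^+ 2 - D * (u n).2%:Z ^+ 2)%R| <= m)%N.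
  elim: n => [|n [IH _]] /=; first by have [] := Hg 1 ltr01.
  by have [] := Hg _ (dist_gt0 _ IH).
have dec n : dist (u n.+1) < dist (u n).
  by have [] := Hg _ (dist_gt0 _ (Hu n).1).
have decr i j : (i < j)%N -> dist (u j) < dist (u i).
  elim: j => // j IH; rewrite ltnS leq_eqVlt => /orP[/eqP ->|/IH]; first exact: dec.
  exact: lt_trans (dec j).
pose t n : int := (u n).1 ^+ 2 - D * (u n).2%:Z ^+ 2.
(* Pigeonhole data: the norm, shifted by [m] to be a natural number, and both coordinates modulo the
   norm. *)
pose cl (n : nat) : 'I_(2 * m).+1 * ('I_m.+1 * 'I_m.+1) :=
  (inord `|(t n + m%:Z)%R|%N, (inord `|((u n).1 %% t n)%Z|%N, inord `|((u n).2%:Z %% t n)%Z|%N)).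
have t0 n : t n != 0.
  rewrite -(intr_eq0 R) /t (pell_norm_factor _ _ sD).
  have [un _] := Hu n; rewrite mulf_neq0//.
    by rewrite -normr_gt0 dist_gt0.
  rewrite addrC addr_eq0 -rmorphN /=; exact: (si _ (u n).2%:Z (lt0n_neq0 un)).
have tm n : (`|t n| <= m)%N by have [] := Hu n.
have modm n (x : int) : (`|(x %% t n)%Z| < m.+1)%N.
  exact: absz_modz_lt (t0 n) (tm n).
pose K := #|{: 'I_(2 * m).+1 * ('I_m.+1 * 'I_m.+1)}|.
have /injectivePn[i [j ij fij]] : ~~ injectiveb (fun i : 'I_K.+1 => cl i).
  by apply/negP => /injectiveP /leq_card; rewrite card_ord ltnn.
move: ij fij; rewrite -val_eqE /=; move: (val i) (val j) => {}i {}j ij fij.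
wlog ltij : i j ij fij / (i < j)%N.
  move=> H; have [/H|ji|e] := ltngtP i j; first exact.
    by apply: (H j i) => //; rewrite eq_sym.
  by rewrite e eqxx in ij.
have [e1 e2 e3] : [/\ t i = t j, ((u i).1 = (u j).1 %[mod t i])%Z &
    ((u i).2%:Z = (u j).2%:Z %[mod t i])%Z].
  case: fij => /(congr1 val) /= + /(congr1 val) /= + /(congr1 val) /=.
  rewrite !inordK ?modm ?absz_shift_lt//.
  move=> /(absz_shift_inj (tm i) (tm j)) e /absz_inj_ge0 h2 /absz_inj_ge0 h3.
  split=> //; rewrite {2}e; [apply: h2 | apply: h3]; exact: modz_ge0.
have [ui _] := Hu i; have [uj _] := Hu j.
apply: (pell_compose (t0 i) (erefl _) (esym e1) _ _ e2 e3); [exact: ui | exact: uj |].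
apply/eqP => -[h1 h2]; have := decr _ _ ltij.
by rewrite /dist h1 h2 ltxx.
Qed.

End QuadraticIrrationals.

(** * The cocycle relation for the principal congruence subgroup of level 2 *)

(* Rational functions over Q are handled semantically, as operations defined in every field and
   preserved by field morphisms; the theorem applies this both to [s] and to the embedding [Qval]. *)
Definition field_family := forall K : fieldType, K -> K.

Definition natural_family (F : field_family) :=
  forall (K L : fieldType) (f : {rmorphism K -> L}) x, f (F K x) = F L (f x).

Section NaturalFamilies.
Implicit Types F G : field_family.

Lemma natural_id : natural_family (fun K x => x). Proof. by []. Qed.

Lemma natural_int (z : int) : natural_family (fun K _ => z%:~R).
Proof. by move=> K L f x; rewrite rmorph_int. Qed.

Lemma natural_rat (q : rat) : natural_family (fun K _ => ratr q).
Proof. by move=> K L f x; rewrite fmorph_rat. Qed.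

Lemma naturalD F G : natural_family F -> natural_family G ->
  natural_family (fun K x => F K x + G K x).
Proof. by move=> hF hG K L f x; rewrite rmorphD hF hG. Qed.

Lemma naturalB F G : natural_family F -> natural_family G ->
  natural_family (fun K x => F K x - G K x).
Proof. by move=> hF hG K L f x; rewrite rmorphB hF hG. Qed.

Lemma naturalM F G : natural_family F -> natural_family G ->
  natural_family (fun K x => F K x * G K x).
Proof. by move=> hF hG K L f x; rewrite rmorphM hF hG. Qed.

Lemma naturalV F : natural_family F -> natural_family (fun K x => (F K x)^-1).
Proof. by move=> hF K L f x; rewrite fmorphV hF. Qed.

Lemma naturalX F n : natural_family F -> natural_family (fun K x => F K x ^+ n).
Proof. by move=> hF K L f x; rewrite rmorphXn hF. Qed.

Lemma natural_comp F G : natural_family F -> natural_family G ->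
  natural_family (fun K x => F K (G K x)).
Proof. by move=> hF hG K L f x; rewrite hF hG. Qed.

Lemma natural_sum n (F : 'I_n -> field_family) : (forall i, natural_family (F i)) ->
  natural_family (fun K x => \sum_(i < n) F i K x).
Proof. by move=> hF K L f x; rewrite rmorph_sum; apply: eq_bigr => i _; rewrite hF. Qed.

Definition affine (c d : int) : field_family := fun K x => c%:~R * x + d%:~R.

Lemma natural_affine c d : natural_family (affine c d).
Proof.
by apply: naturalD; [apply: naturalM; [exact: natural_int | exact: natural_id]
  | exact: natural_int].
Qed.

Definition moebius (a b c d : int) : field_family := fun K x => affine a b x / affine c d x.

Lemma natural_moebius a b c d : natural_family (moebius a b c d).
Proof. by apply: naturalM; [|apply: naturalV]; exact: natural_affine. Qed.

Definition even_poly k (q : nat -> rat) : field_family :=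
  fun K x => \sum_(j < k.+1) ratr (q j) * (2%:~R * x) ^+ (2 * j).

Lemma natural_even_poly k q : natural_family (even_poly k q).
Proof.
apply: natural_sum => i; apply: naturalM; first exact: natural_rat.
by apply: naturalX; apply: naturalM; [exact: natural_int | exact: natural_id].
Qed.

End NaturalFamilies.

Section Cocycle.
Variable R : realType.
Implicit Types x y : R.

Lemma secant_zetaE x s (l : R) :
  (fun N => \sum_(n < N) sec (pi * n.+1%:R * x) / n.+1%:R ^+ s) @ \oo --> l ->
  secant_zeta x s = l.
Proof.
move=> h; apply: cvg_lim => //; rewrite -cvg_shiftS.
set g := (X in X @ \oo --> _).
suff -> : g = (fun N => \sum_(n < N) sec (pi * n.+1%:R * x) / n.+1%:R ^+ s) by [].
by apply/funext => N; rewrite /g /mk_sequence big_add1 big_mkord.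
Qed.

Lemma cosD2npi x (z : int) : cos (x + 2 * pi * z%:~R) = cos x.
Proof.
have H n y : cos (y + 2 * pi * n%:R) = cos y.
  by rewrite mulr_natr -(periodicn (@cosD2pi R) n y) mulr_natl.
case: z => n; first by rewrite -pmulrn H.
by rewrite NegzE rmorphN /= mulrN -[LHS](H n.+1) subrK.
Qed.

Lemma secant_zeta_translate x (q : int) s :
  secant_zeta (x + 2 * q%:~R) s = secant_zeta x s.
Proof.
rewrite /secant_zeta; congr (limn _); apply/funext => N; apply: eq_bigr => n _.
congr (_ / _); rewrite /sec; congr (_^-1).
rewrite -(cosD2npi (pi * n%:R * x) (n%:Z * q)); congr cos.
by rewrite intrM -pmulrn; ring.
Qed.

(** The weights [2 (k - j)] of the zeta value and [2 j] of [4 / pi] times the beta value always add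
    up to [2 k]. *)
Lemma graded_value k : exists q : nat -> rat, forall a : R,
  4 / pi * \sum_(j < k.+1) (a ^+ (2 * j) * zeta_even R (k - j) * beta_odd R j) =
  pi ^+ (2 * k) * \sum_(j < k.+1) ratr (q j) * a ^+ (2 * j).
Proof.
have /choice[q Hq] : forall j, exists q : rat, (j <= k)%N ->
    zeta_even R (k - j) * (4 / pi * beta_odd R j) = pi ^+ (2 * k) * ratr q.
  move=> j; have [jk|] := leqP j k; last by exists 0.
  have := gradedM (graded_zeta R (k - j)) (graded_beta R j); rewrite subnK// => -[q Hq].
  by exists q.
exists q => a; rewrite !mulr_sumr; apply: eq_bigr => j _.
by rewrite [RHS]mulrA -Hq; [ring | rewrite -ltnS].
Qed.

(** For the image [y] of [x], [1 / (2 y) = 1 / (2 x) - z]; multiplied by an odd integer the shift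
    remains an integer, a period of [cot (pi t)]. *)
Lemma cot_term_moebius k x (z : int) m : quadratic_irr x ->
  cot_term (2 * (x / (1 - 2 * z%:~R * x))) k m = cot_term (2 * x) k m.
Proof.
move=> hx; have x0 : x != 0.
  by have := badly_approximable_neq0 (quadratic_irr_bad hx); apply: contra => /eqP ->; rewrite mulr0.
have w0 : 1 - 2 * z%:~R * x != 0.
  have := irrational_den (c := - (2 * z)) (d := 1) hx.1 _; rewrite orbT => /(_ isT).
  by rewrite rmorphN rmorphM /= mulNr addrC.
rewrite /cot_term; congr (_ * (_ * _) / _).
rewrite -(cotDnpi (pi * (odd_nat R m / (2 * x))) (- z * (m.*2.+1)%:Z)); congr cot.
rewrite rmorphM rmorphN /= -pmulrn -/(odd_nat R m).
by field; rewrite x0 w0.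
Qed.

(** Both points share the same cotangent sum, which is eliminated; the factor is the ratio of the
    powers [(2 x)^(2 k - 1)] in front of it. *)
Lemma secant_zeta_moebius k (q : nat -> rat) x (z : int) : (0 < k)%N ->
  (forall a : R,
    4 / pi * \sum_(j < k.+1) (a ^+ (2 * j) * zeta_even R (k - j) * beta_odd R j) =
    pi ^+ (2 * k) * \sum_(j < k.+1) ratr (q j) * a ^+ (2 * j)) ->
  quadratic_irr x -> quadratic_irr (x / (1 - 2 * z%:~R * x)) ->
  secant_zeta x (2 * k) = pi ^+ (2 * k) * even_poly k q x +
    (1 - 2 * z%:~R * x) ^+ (2 * k).-1 *
    (secant_zeta (x / (1 - 2 * z%:~R * x)) (2 * k) -
      pi ^+ (2 * k) * even_poly k q (x / (1 - 2 * z%:~R * x))).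
Proof.
move=> k0 Hq hx hy.
have value y : quadratic_irr y -> exists2 Phi : R,
    (fun M => \sum_(m < M) cot_term (2 * y) k m) @ \oo --> Phi &
    secant_zeta y (2 * k) = pi ^+ (2 * k) * even_poly k q y + 2 / pi * (2 * y) ^+ (2 * k).-1 * Phi.
  move=> {}hy; have [Phi h1 h2] := secant_sum_value (quadratic_irr_bad hy) k0.
  exists Phi => //; rewrite /even_poly -Hq; apply: secant_zetaE.
  have e : 2 * y / 2 = y by field.
  by rewrite e in h2.
have [Phi h1 ->] := value x hx; have [Psi h2 ->] := value _ hy.
have -> : Phi = Psi.
  apply: (@cvg_unique _ (@Rhausdorff R) ((fun M => \sum_(m < M) cot_term (2 * x) k m) @ \oo)) => //.
  have <- : (fun M => \sum_(m < M) cot_term (2 * (x / (1 - 2 * z%:~R * x))) k m) =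
     (fun M => \sum_(m < M) cot_term (2 * x) k m); last by [].
  by apply/funext => M; apply: eq_bigr => m _; exact: cot_term_moebius.
have w0 : 1 - 2 * z%:~R * x != 0.
  have := irrational_den (c := - (2 * z)) (d := 1) hx.1 _; rewrite orbT => /(_ isT).
  by rewrite rmorphN rmorphM /= mulNr addrC.
have -> : (2 * (x / (1 - 2 * z%:~R * x))) ^+ (2 * k).-1 =
   (2 * x) ^+ (2 * k).-1 / (1 - 2 * z%:~R * x) ^+ (2 * k).-1.
  by rewrite mulrA expr_div_n.
have := expf_neq0 (2 * k).-1 w0; move: (_ ^+ _) ((2 * x) ^+ _) => u v u0.
rewrite addrC; rewrite [X in _ = _ + _ * X]addrC addKr.
rewrite addrC; congr (_ + _).
rewrite (_ : u * (2 / pi * (v / u) * Psi) = 2 / pi * v * Psi * (u / u)); last by ring.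
by rewrite divff// mulr1.
Qed.

(** The sign [eps] compensates for [affine c d x ^+ (2 * k).-1] being odd under [-1]. *)
Definition secant_cocycle k (a b c d : int) := exists2 F : field_family, natural_family F &
  exists2 eps : int, (eps == 1) || (eps == -1) & forall x, quadratic_irr x ->
    secant_zeta x (2 * k) - eps%:~R * affine c d x ^+ (2 * k).-1 *
      secant_zeta (moebius a b c d x) (2 * k) = pi ^+ (2 * k) * F R x.

(** Left multiplication by [(1 2q; 0 1)], which keeps the bottom row and therefore the automorphy
    factor. *)
Lemma secant_cocycle_translate k a b c d (q : int) : a * d - b * c = 1 ->
  secant_cocycle k a b c d -> secant_cocycle k (a + 2 * q * c) (b + 2 * q * d) c d.
Proof.
move=> det [F hF [eps heps H]]; exists F => //; exists eps => // x hx.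
rewrite -H//; congr (_ - _ * _).
rewrite -(secant_zeta_translate (moebius a b c d x) q); congr (secant_zeta _ _).
have cd : (c != 0) || (d != 0).
  by apply/negPn/negP; rewrite negb_or !negbK => /andP[/eqP c0 /eqP d0]; move: det; rewrite c0 d0; lia.
have D0 := irrational_den hx.1 cd.
rewrite /moebius /affine !(rmorphD, rmorphM) /=.
by field.
Qed.

(** Left multiplication by [(1 0; -2q 1)]: the reciprocity is applied at the image of [x], and [wE]
    is the chain rule for the automorphy factor. *)
Lemma secant_cocycle_invert k a b c d (q : int) : (0 < k)%N -> a * d - b * c = 1 ->
  secant_cocycle k a b c d -> secant_cocycle k a b (c - 2 * q * a) (d - 2 * q * b).
Proof.
move=> k0 det [F hF [eps heps H]]; have [e He] := graded_value k.
exists (fun (K : fieldType) (x : K) => F K x + eps%:~R * (affine c d x ^+ (2 * k).-1 * even_poly k e (moebius a b c d x) -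
   affine (c - 2 * q * a) (d - 2 * q * b) x ^+ (2 * k).-1 *
   even_poly k e (moebius a b (c - 2 * q * a) (d - 2 * q * b) x))).
  apply: naturalD => //; apply: naturalM; first exact: natural_int.
  apply: naturalB; (apply: naturalM; first by apply: naturalX; exact: natural_affine);
    (apply: (@natural_comp (even_poly k e)); [exact: natural_even_poly | exact: natural_moebius]).
exists eps => // x hx.
have det' : a * (d - 2 * q * b) - b * (c - 2 * q * a) = 1 by apply: etrans det; ring.
have hy := quadratic_irr_moebius det hx; have hy' := quadratic_irr_moebius det' hx.
have cd : (c != 0) || (d != 0).
  by apply/negPn/negP; rewrite negb_or !negbK => /andP[/eqP c0 /eqP d0]; move: det; rewrite c0 d0; lia.
have cd' : (c - 2 * q * a != 0) || (d - 2 * q * b != 0).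
  by apply/negPn/negP; rewrite negb_or !negbK => /andP[/eqP c0 /eqP d0]; move: det'; rewrite c0 d0; lia.
have D0 := irrational_den hx.1 cd; have D0' := irrational_den hx.1 cd'.
have wE : 1 - 2 * q%:~R * moebius a b c d x = affine (c - 2 * q * a) (d - 2 * q * b) x / affine c d x.
  rewrite /moebius /affine !(rmorphB, rmorphM) /=; by field.
have yE : moebius a b c d x / (1 - 2 * q%:~R * moebius a b c d x) =
    moebius a b (c - 2 * q * a) (d - 2 * q * b) x.
  rewrite wE /moebius; move: D0 D0'; rewrite -/(affine c d x) -/(affine _ _ x) => D0 D0'.
  by field; rewrite D0 D0'.
have := @secant_zeta_moebius k e _ q k0 He hy; rewrite -/(affine a b x) -/(affine c d x).
rewrite -/(moebius a b c d x) yE => /(_ hy').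
have := H x hx; rewrite wE expr_div_n.
have := expf_neq0 (2 * k).-1 D0; rewrite -/(affine c d x).
move: (affine c d x ^+ (2 * k).-1) => j j0.
move: (affine (c - 2 * q * a) _ x ^+ (2 * k).-1) => j'.
move: (secant_zeta x _) (secant_zeta (moebius a b c d x) _) => s1 s2.
move: (secant_zeta _ _) => s3 h1 h2.
rewrite mulrDr -h1 h2.
by field.
Qed.

(** Euclid's algorithm on the first column [(a, 2 c)] with even quotients: twice the smaller entry
    is removed from the larger, up to sign, which strictly lowers [|a| + |2 c|]. It ends at [c = 0],
    where the map is a translation by an even integer. *)
Lemma secant_cocycle_Gamma2 k (a b c d : int) : (0 < k)%N -> a * d - (2 * b) * (2 * c) = 1 ->
  secant_cocycle k a (2 * b) (2 * c) d.
Proof.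
move=> k0; have [n] := ubnP (`|a| + `|(2 * c)%R|)%N.
elim: n a b c d => // n IH a b c d nac det.
have [c0|c0] := eqVneq c 0.
  have ad : a * d = 1 by apply: etrans det; rewrite c0; ring.
  have /eqP := congr1 absz ad; rewrite abszM muln_eq1 => /andP[/eqP a1 _].
  have {a1} [[ae de]|[ae de]] : a = 1 /\ d = 1 \/ a = -1 /\ d = -1.
    have [ae|ae] : a = 1 \/ a = -1 by clear -a1; lia.
      by left; rewrite ae mul1r in ad.
    by right; rewrite ae mulN1r in ad; split=> //; rewrite -ad opprK.
  - exists (fun K _ => 0%:~R); first exact: natural_int.
    exists 1 => // x hx; rewrite mulr0 /moebius /affine c0 ae de mulr0 mul0r add0r expr1n !mul1r divr1.
    by rewrite intrM secant_zeta_translate subrr.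
  - exists (fun K _ => 0%:~R); first exact: natural_int.
    exists (-1) => // x hx; rewrite mulr0 /moebius /affine c0 ae de mulr0 mul0r add0r.
    have -> : ((-1)%:~R * x + (2 * b)%:~R) / (-1)%:~R = x + 2 * (- b)%:~R.
      by rewrite intrM !rmorphN /= !mulr1z invrN1; ring.
    by rewrite secant_zeta_translate -exprS prednK ?muln_gt0// rmorphN exprM sqrrN !expr1n mul1r subrr.
have a0 : a != 0.
  by apply/eqP => a0; move: det; rewrite a0 mul0r; move: (b * c) => ?; lia.
have [ac|ac|ac] := ltngtP `|(2 * c)%R|%N `|a|%N.
- have [q hq] : exists q : int, (`|(a - 2 * q * (2 * c))%R| < `|a|)%N.
    have [h|h] : (`|(a - 2 * 1 * (2 * c))%R| < `|a|)%N \/ (`|(a - 2 * (-1) * (2 * c))%R| < `|a|)%N.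
      by clear -ac c0; lia.
    - by exists 1.
    - by exists (-1).
  have det' : (a - 2 * q * (2 * c)) * d - (2 * (b - q * d)) * (2 * c) = 1 by apply: etrans det; ring.
  have := IH (a - 2 * q * (2 * c)) (b - q * d) c d _ det'.
  move=> /(_ ltac:(clear -hq nac; lia)) /(secant_cocycle_translate q det').
  have -> : a - 2 * q * (2 * c) + 2 * q * (2 * c) = a by ring.
  by have -> : 2 * (b - q * d) + 2 * q * d = 2 * b by ring.
- have [q hq] : exists q : int, (`|(2 * (c + q * a))%R| < `|(2 * c)%R|)%N.
    have [h|h] : (`|(2 * (c + 1 * a))%R| < `|(2 * c)%R|)%N \/ (`|(2 * (c + (-1) * a))%R| < `|(2 * c)%R|)%N.
      by clear -ac a0; lia.
    - by exists 1.
    - by exists (-1).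
  have det' : a * (d + 2 * q * (2 * b)) - (2 * b) * (2 * (c + q * a)) = 1 by apply: etrans det; ring.
  have := IH a b (c + q * a) (d + 2 * q * (2 * b)) _ det'.
  move=> /(_ ltac:(clear -hq nac; lia)) /(secant_cocycle_invert q k0 det').
  have -> : 2 * (c + q * a) - 2 * q * a = 2 * c by ring.
  by have -> : d + 2 * q * (2 * b) - 2 * q * (2 * b) = d by ring.
(* A tie would make the determinant even. *)
- have [ae|ae] : a = 2 * c \/ a = - (2 * c) by clear -ac; lia.
    have : 2 * (c * d - 2 * b * c) = 1 by apply: etrans det; rewrite ae; ring.
    by move: (c * d - _) => ?; lia.
  have : 2 * (- (c * d) - 2 * b * c) = 1 by apply: etrans det; rewrite ae; ring.
  by move: (- (c * d) - _) => ?; lia.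
Qed.

End Cocycle.

(** * Fixed points and the field Q(alpha) *)

Section Stabilizer.
Variable R : realType.
Implicit Types x y : R.

(** [G] is chosen before [y], so a single expression serves both roots of the equation. *)
Lemma secant_zeta_natural k x (A B C : int) : (0 < k)%N -> irrational x -> A != 0 ->
  A%:~R * x ^+ 2 + B%:~R * x + C%:~R = 0 ->
  exists2 G : field_family, natural_family G & forall y, irrational y ->
    A%:~R * y ^+ 2 + B%:~R * y + C%:~R = 0 ->
    secant_zeta y (2 * k) = pi ^+ (2 * k) * G R y.
Proof.
move=> k0 ix A0 Ex.
have disc y : A%:~R * y ^+ 2 + B%:~R * y + C%:~R = 0 ->
    (2 * A%:~R * y + B%:~R) ^+ 2 = (B ^+ 2 - 4 * A * C)%:~R :> R.
  move=> E; rewrite rmorphB rmorphXn !rmorphM /= -[RHS]addr0.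
  rewrite -[X in _ = _ + X](mulr0 (4 * A%:~R)) -E; ring.
have isr : irrational (2 * A%:~R * x + B%:~R).
  move=> p q q0; apply/eqP => h.
  have := ix (p - q * B) (2 * q * A); rewrite !mulf_neq0// => /(_ isT) /eqP; apply.
  by rewrite rmorphB !rmorphM /= -h; ring.
have [X [Y [Y0 XY]]] := pell (disc x Ex) isr.
(* The classical automorph of the form [(A, B, C)]: its determinant is [X^2 - (B^2 - 4 A C) Y^2],
   and its off-diagonal entries are even by construction. *)
have det : (X - B * Y) * (X + B * Y) - (2 * (- C * Y)) * (2 * (A * Y)) = 1.
  by apply: etrans XY; ring.
have [F hF [eps heps H]] := secant_cocycle_Gamma2 R k0 det.
set c := 2 * (A * Y) in H; set d := X + B * Y in H.
exists (fun (K : fieldType) (y : K) => F K y * (1%:~R - eps%:~R * affine c d y ^+ (2 * k).-1)^-1).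
  apply: naturalM => //; apply: naturalV; apply: naturalB; first exact: natural_int.
  apply: naturalM; first exact: natural_int.
  by apply: naturalX; exact: natural_affine.
move=> y iy Ey; have hy : quadratic_irr y by split=> //; exists A, B, C.
have c0 : c != 0 by rewrite !mulf_neq0.
have j0 : affine c d y != 0 by apply: irrational_den => //; rewrite c0.
have fixed : moebius (X - B * Y) (2 * (- C * Y)) c d y = y.
  apply: (mulIf j0); rewrite /moebius divfK//.
  have <- : Y%:~R * 2 * (A%:~R * y ^+ 2 + B%:~R * y + C%:~R) +
      affine (X - B * Y) (2 * (- C * Y)) y = y * affine c d y.
    rewrite /affine /c /d !(rmorphD, rmorphB, rmorphM, rmorphN) /=; ring.
  by rewrite Ey mulr0 add0r.
have := H y hy; rewrite fixed => h.
(* If this vanished, [|c y + d|] would be [1] because [2 k - 1 > 0], and [y] would be rational since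
   [c] is nonzero. *)
suff n0 : 1 - eps%:~R * affine c d y ^+ (2 * k).-1 != 0.
  by apply: (mulIf n0); rewrite mulr1z -!mulrA mulVf// mulr1 -h; ring.
rewrite subr_eq0; apply/eqP => /(congr1 (fun z => `|z|)).
rewrite normr1 normrM normrX => /esym.
have -> : `|eps%:~R| = 1 :> R.
  by case/orP: heps => /eqP ->; rewrite ?rmorphN ?normrN normr1.
rewrite mul1r => /eqP; rewrite pexpr_eq1 ?normr_ge0//; last by move: k0; clear; lia.
have nj (z : int) : affine c d y <> z%:~R.
  move=> E; have /eqP := iy (z - d) c c0; apply.
  by rewrite rmorphB /= -E /affine addrK.
have [_ /eqP E|_ /eqP E] := ger0P (affine c d y); first exact: (nj 1).
by apply: (nj (-1)); rewrite rmorphN /= -[LHS]opprK E.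
Qed.

(** Meant for [f = val] and [g = val \o s]: both are injective and fix the integers, so relations
    pass from [alpha] to its conjugate through the field [K]. *)
Lemma irrational_rmorph (K : fieldType) (f g : {rmorphism K -> R}) (x : K) :
  irrational (f x) -> irrational (g x).
Proof.
move=> ix p q q0; apply/eqP => h; have /eqP := ix p q q0; apply.
have : g (q%:~R * x - p%:~R) == 0 by rewrite rmorphB rmorphM !rmorph_int h subrr.
by rewrite fmorph_eq0 subr_eq0 => /eqP E; rewrite -(rmorph_int f q) -rmorphM E rmorph_int.
Qed.

Lemma quadratic_rmorph (K : fieldType) (f g : {rmorphism K -> R}) (x : K) (A B C : int) :
  A%:~R * f x ^+ 2 + B%:~R * f x + C%:~R = 0 -> A%:~R * g x ^+ 2 + B%:~R * g x + C%:~R = 0.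
Proof.
have E (h : {rmorphism K -> R}) : A%:~R * h x ^+ 2 + B%:~R * h x + C%:~R =
    h (A%:~R * x ^+ 2 + B%:~R * x + C%:~R).
  by rewrite 2!rmorphD [h (A%:~R * _)]rmorphM [h (B%:~R * _)]rmorphM rmorphXn !rmorph_int.
by rewrite !E => /eqP; rewrite fmorph_eq0 => /eqP ->; rewrite rmorph0.
Qed.

End Stabilizer.

Section QuadraticField.
Variables (R : realType) (alpha : R).

Let valM : {rmorphism Qfield alpha -> R} := val.

(** The rational numbers are then one of the subfields over which [Qadjoin] is the smallest. *)
Lemma Qfield_rational (r : rat) : alpha = ratr r -> forall x : Qfield alpha, exists q : rat, x = ratr q.
Proof.
move=> ar x; have : exists q : rat, Qval x = ratr q.
  have := QvalP x; rewrite /Qadjoin unfold_in /= in_setE.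
  move=> /(_ [set y : R | exists q : rat, y = ratr q]); apply; split.
    split=> [|y z|y z]; rewrite !in_setE /=.
    - by exists 1; rewrite rmorph1.
    - by move=> [p ->] [q ->]; exists (p - q); rewrite rmorphB.
    - by move=> [p ->] [q ->]; exists (p / q); rewrite fmorph_div.
  by move=> _ ->; exists r.
move=> [q xq]; exists q; apply: val_inj; rewrite [RHS](fmorph_rat valM); exact: xq.
Qed.

Lemma QvalD (x y : Qfield alpha) : Qval (x + y) = Qval x + Qval y.
Proof. exact: (rmorphD valM). Qed.

Lemma Qval_scale (a : rat) (x : Qfield alpha) : Qval (ratr a * x) = ratr a * Qval x.
Proof. by rewrite [LHS](rmorphM valM) (fmorph_rat valM). Qed.

Lemma quadratic_irrationality_basis : quadratic_irrationality alpha ->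
  exists x0 x1 : Qfield alpha,
    (forall a b : rat, ratr a * Qval x0 + ratr b * Qval x1 = 0 -> a = 0 /\ b = 0) /\
    (forall x : Qfield alpha, exists a b : rat, Qval x = ratr a * Qval x0 + ratr b * Qval x1).
Proof.
move=> [e he]; exists (e ord0), (e (lift ord0 ord0)); split=> [a b ab|x].
  have [c0 [_ hc0]] := he 0.
  have E1 : c0 = [ffun=> 0].
    by apply: hc0; rewrite big1// => j _; rewrite ffunE /ratr mul0r mul0r.
  have E2 : c0 = [ffun i => if i == ord0 then a else b].
    apply: hc0; rewrite !big_ord_recl big_ord0 addr0 !ffunE /=; apply: val_inj.
    rewrite -[RHS]/(Qval _) QvalD !Qval_scale ab; exact: (rmorph0 valM).
  have /ffunP E := etrans (esym E2) E1.
  by have := E ord0; have := E (lift ord0 ord0); rewrite !ffunE /= => -> ->.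
have [c [hc _]] := he x; exists (c ord0), (c (lift ord0 ord0)).
rewrite {1}hc !big_ord_recl big_ord0 addr0.
by rewrite QvalD !Qval_scale.
Qed.

Lemma quadratic_irrationality_irrational : quadratic_irrationality alpha -> irrational alpha.
Proof.
move=> /quadratic_irrationality_basis[x0 [x1 [uniq _]]] p q q0; apply/eqP => h.
have ar : alpha = ratr (p%:~R / q%:~R).
  by rewrite fmorph_div /= !ratr_int -h mulrC mulKf// intr_eq0.
have [c0 e0] := Qfield_rational ar x0; have [c1 e1] := Qfield_rational ar x1.
have {}e0 : Qval x0 = ratr c0 by rewrite e0 [LHS](fmorph_rat valM).
have {}e1 : Qval x1 = ratr c1 by rewrite e1 [LHS](fmorph_rat valM).
(* Rational basis elements satisfy [c1 x0 - c0 x1 = 0]; independence gives [c0 = 0], so [x0 = 0],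
   against independence with coefficients [1, 0]. *)
have [|_ /eqP c00] := uniq c1 (- c0).
  by rewrite e0 e1 rmorphN /=; ring.
rewrite oppr_eq0 in c00; rewrite (eqP c00) in e0.
have [|/eqP] := uniq 1 0; last by rewrite oner_eq0.
by rewrite e0 (_ : ratr 0 = 0) ?mulr0 ?mul0r ?addr0//; exact: rmorph0.
Qed.

Lemma quadratic_irrationality_eqn : quadratic_irrationality alpha ->
  exists A B C : int, A != 0 /\ A%:~R * alpha ^+ 2 + B%:~R * alpha + C%:~R = 0.
Proof.
move=> hq; have ia := quadratic_irrationality_irrational hq.
have ir (r : rat) : alpha != ratr r.
  apply/eqP => ar; have /eqP := ia (numq r) (denq r) (denq_neq0 r); apply.
  by rewrite ar /ratr mulrC divfK// intr_eq0 denq_neq0.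
have [x0 [x1 [_ gen]]] := quadratic_irrationality_basis hq; pose g := Qgen alpha.
have [p0 [q0 h0]] := gen 1; have [p1 [q1 h1]] := gen g; have [p2 [q2 h2]] := gen (g * g).
rewrite [LHS](rmorph1 valM) in h0; rewrite [LHS](rmorphM valM) in h2.
rewrite -[Qval g]/alpha in h1; rewrite -[valM g]/alpha in h2.
move: (Qval x0) (Qval x1) h0 h1 h2 => e0 e1 h0 h1 h2.
have gr (u v : rat) : u != 0 -> ratr u * alpha <> ratr v.
  move=> u0 E; have /eqP := ir (v / u); apply.
  by rewrite fmorph_div /= -E mulrC mulKf// fmorph_eq0.
(* The 2 by 2 minors of the coordinates of [1, alpha, alpha^2] give the linear relation between
   these three vectors. *)
pose A := p0 * q1 - q0 * p1; pose B := q0 * p2 - p0 * q2; pose C := p1 * q2 - q1 * p2.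
have ER : ratr A * alpha ^+ 2 + ratr B * alpha + ratr C = 0 :> R.
  rewrite expr2 -[ratr C]mulr1 h2 h0 h1 !rmorphB !rmorphM /=; ring.
have A0 : A != 0.
  (* A vanishing minor gives [p0 alpha = p1] and [q0 alpha = q1], hence [p0 = q0 = 0], and the
     coordinates of [1] would vanish. *)
  apply/eqP => A0.
  have hh : ratr p0 * ratr q1 - ratr q0 * ratr p1 = 0 :> R.
    by rewrite -!rmorphM -rmorphB -/A A0; exact: rmorph0.
  have k1 : ratr p0 * alpha = ratr p1.
    apply/eqP; rewrite -subr_eq0 -[ratr p1]mulr1 h0 h1; apply/eqP.
    transitivity ((ratr p0 * ratr q1 - ratr q0 * ratr p1) * e1); first by ring.
    by rewrite hh mul0r.
  have k2 : ratr q0 * alpha = ratr q1.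
    apply/eqP; rewrite -subr_eq0 -[ratr q1]mulr1 h0 h1; apply/eqP.
    transitivity (- (ratr p0 * ratr q1 - ratr q0 * ratr p1) * e0); first by ring.
    by rewrite hh oppr0 mul0r.
  have [p00|p00] := eqVneq p0 0; last exact: (gr _ p1 p00).
  have [q00|q00] := eqVneq q0 0; last exact: (gr _ q1 q00).
  move/eqP: h0; rewrite p00 q00 (_ : ratr 0 = 0); last exact: rmorph0.
  by rewrite !mul0r addr0 oner_eq0.
exists (numq A * denq B * denq C), (numq B * denq A * denq C), (numq C * denq A * denq B); split.
  by rewrite !mulf_neq0 ?denq_neq0// numq_eq0.
have dA : (denq A)%:~R != 0 :> R by rewrite intr_eq0 denq_neq0.
have dB : (denq B)%:~R != 0 :> R by rewrite intr_eq0 denq_neq0.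
have dC : (denq C)%:~R != 0 :> R by rewrite intr_eq0 denq_neq0.
transitivity ((denq A)%:~R * (denq B)%:~R * (denq C)%:~R *
   (ratr A * alpha ^+ 2 + ratr B * alpha + ratr C)); last by rewrite ER mulr0.
rewrite /ratr !intrM; move: dA dB dC; move: ((denq A)%:~R) ((denq B)%:~R) ((denq C)%:~R : R).
move=> a b c a0 b0 c0; by field; rewrite a0 b0 c0.
Qed.

End QuadraticField.

Theorem theorem3 (R : realType) (alpha : R) (k : nat)
  (halpha : quadratic_irrationality alpha) (hk : (0 < k)%N) :
  exists2 v : Qfield alpha,
    Qval v = secant_zeta alpha (2 * k)%N / pi ^+ (2 * k)%N
    & forall s : {rmorphism Qfield alpha -> Qfield alpha},
        bijective s -> (exists x, s x <> x) ->
        Qval (s v) = secant_zeta (Qval (s (Qgen alpha))) (2 * k)%N / pi ^+ (2 * k)%N.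
Proof.
have ia := quadratic_irrationality_irrational halpha.
have [A [B [C [A0 E]]]] := quadratic_irrationality_eqn halpha.
have [G hG value] := secant_zeta_natural hk ia A0 E.
have pk : pi ^+ (2 * k) != 0 :> R by rewrite expf_neq0// gt_eqF// pi_gt0.
have GE y : irrational y -> A%:~R * y ^+ 2 + B%:~R * y + C%:~R = 0 ->
    G R y = secant_zeta y (2 * k) / pi ^+ (2 * k).
  by move=> iy Ey; rewrite value// mulrC mulKf.
(* Evaluating [G] inside [Qfield alpha] gives membership in the field, and naturality under [val]
   compares it with the real value. *)
pose g := Qgen alpha; have valG x : Qval (G (Qfield alpha) x) = G R (Qval x).
  exact: (hG (Qfield alpha) R (val : {rmorphism Qfield alpha -> R}) x).
exists (G (Qfield alpha) g); first by rewrite valG; exact: GE.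
(* Naturality moves [s] inside [G]; what remains is the same formula at another irrational root of
   the same equation. *)
move=> s _ _; rewrite hG valG; apply: GE.
  exact: (@irrational_rmorph R _ val (val \o s) g ia).
exact: (@quadratic_rmorph R _ val (val \o s) g A B C E).
Qed.
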